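(* Let a multispindle $X=(X;\star_1,\dots,\star_r)$ act on an $R$-module $M$ (with fixed weights $a_1,\dots,a_r\in R$). Then there is a spectral sequence $(E^r,\partial^r)$ converging to the degenerate multiterm homology $H^D(M;X)$ such that $E^2_{pq}=H^N_p\big(\widehat H_{q-2}(M;X);X\big)$ for all $p,q$.
   Context: Let $R$ be a commutative ring with unit. A spindle is a set $X$ with a binary operation $\star$ such that $x\star x=x$ and $(x\star y)\star z=(x\star z)\star(y\star z)$; it is a quandle if every map $x\mapsto x\star y$ is invertible. A multispindle $(X;\star_1,\dots,\star_r)$ is a set with spindle operations satisfying $(x\star_i y)\star_j z=(x\star_j z)\star_i(y\star_j z)$ for all $i,j$ and all $x,y,z\in X$. An action of $X$ on an $R$-module $M$ consists of functions $\star_i\colon M\times X\to M$, linear in the first variable, with $(m\star_i x)\star_j y=(m\star_j y)\star_i(x\star_j y)$ (for a quandle $(X,\star)$ one also requires each $m\mapsto m\star x$ to be invertible). Fix weights $a_1,\dots,a_r\in R$. The compound action is $m\cdot x:=\sum_k a_k(m\star_k x)$. Chain complex: $C_n(M;X):=M\otimes R\langle X^{n+1}\rangle$ for $n\ge 0$, sequences being written $(x_n,\dots,x_0)$, with face maps $d_i^{\star_k}(m\otimes(x_n,\dots,x_0))=(m\star_k x_i)\otimes(x_n\star_k x_i,\dots,x_{i+1}\star_k x_i,x_{i-1},\dots,x_0)$ and differential $\partial=\sum_k a_k\sum_{i=0}^n(-1)^{n-i}d_i^{\star_k}$. The degenerate subcomplex $C^D(M;X)$ is spanned by $m\otimes(x_n,\dots,x_0)$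 with $x_i=x_{i+1}$ for some $i$; the normalized complex is $C^N(M;X)=C(M;X)/C^D(M;X)$. Their homologies are $H^D(M;X)$ and $H^N(M;X)$. The augmented complex $\widehat C(M;X)$ is $C(M;X)$ extended by $\widehat C_{-1}(M;X)=M$ with the map $C_0(M;X)\to M$, $m\otimes x\mapsto m\cdot x$ (and $0$ in degrees $<-1$); its homology is $\widehat H(M;X)$. $X$ acts on $\widehat C(M;X)$ by $(m\otimes(x_n,\dots,x_0))\star_i y=(m\star_i y)\otimes(x_n\star_i y,\dots,x_0\star_i y)$ (and by the given action in degree $-1$), hence on each $\widehat H_q(M;X)$. Normalized homology with coefficients in $\widehat H_{q-2}(M;X)$ is taken with the same weights. Spectral sequences are homological and first quadrant ($E^r_{pq}=0$ if $p<0$ or $q<0$), with $\partial^r$ of bidegree $(-r,r-1)$. Convergence to a graded module $H$ means that there is a filtration $\mathcal F^0H_n\subset\mathcal F^1H_n\subset\cdots$ of each $H_n$, exhausting $H_n$ in finitely many steps, with $E^\infty_{pq}\cong\mathcal F^pH_{p+q}/\mathcal F^{p-1}H_{p+q}$ (where $\mathcal F^{-1}=0$). *)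

(* Defs.v *)
From HB Require Import structures.
From mathcomp Require Import all_boot all_algebra finmap boolp.
From mathcomp Require Import monalg.

Set Implicit Arguments.
Unset Strict Implicit.
Unset Printing Implicit Defensive.

Import GRing.Theory.
Local Open Scope ring_scope.
Local Open Scope quotient_scope.

Section Submodule.
Variables (R : comPzRingType) (V : lmodType R).

Record submod (S : submodClosed V) :=
  Submod { submod_val : V; submod_valP : submod_val \in S }.

HB.instance Definition _ (S : submodClosed V) :=
  [isSub of submod S for @submod_val S].
HB.instance Definition _ (S : submodClosed V) := [Choice of submod S by <:].
HB.instance Definition _ (S : submodClosed V) :=
  [SubChoice_isSubLmodule of submod S by <:].

Section Quotient.
Variable S : submodClosed V.

Lemma submod_oppr_closed : oppr_closed S.
Proof. by move=> x xS; rewrite -scaleN1r rpredZ. Qed.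

Definition submod_zmod : zmodClosed V :=
  HB.pack (GRing.SubmodClosed.sort S) (GRing.isOppClosed.Build V S submod_oppr_closed).

Definition quomod := Quotient.quot submod_zmod.
HB.instance Definition _ := GRing.Zmodule.on quomod.

Definition quo_pi (x : V) : quomod := \pi_quomod x.

Lemma quo_piP x y : reflect (quo_pi x = quo_pi y) (x - y \in S).
Proof.
rewrite (_ : (x - y \in S) = (quo_pi x == quo_pi y)); first exact: eqP.
exact: (Quotient.idealrBE submod_zmod).
Qed.

Lemma quo_piD : {morph quo_pi : x y / x + y}.
Proof. by move=> x y; rewrite /quo_pi (Quotient.pi_add submod_zmod). Qed.

Lemma quo_pi_repr (u : quomod) : quo_pi (repr u) = u.
Proof. exact: reprK. Qed.

Lemma quo_repr_pi x : repr (quo_pi x) - x \in S.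
Proof. by apply/quo_piP; rewrite quo_pi_repr. Qed.

Definition quo_scale (a : R) (u : quomod) : quomod := quo_pi (a *: repr u).

Lemma quo_scale_pi a x : quo_scale a (quo_pi x) = quo_pi (a *: x).
Proof. by apply/quo_piP; rewrite -scalerBr rpredZ ?quo_repr_pi. Qed.

Fact quo_scaleA a b u : quo_scale a (quo_scale b u) = quo_scale (a * b) u.
Proof. by rewrite -[u]quo_pi_repr !quo_scale_pi scalerA. Qed.
Fact quo_scale1 : left_id 1 quo_scale.
Proof. by move=> u; rewrite -[u]quo_pi_repr quo_scale_pi scale1r. Qed.
Fact quo_scaleDr : right_distributive quo_scale +%R.
Proof.
move=> a u v; rewrite -[u]quo_pi_repr -[v]quo_pi_repr.
by rewrite -quo_piD !quo_scale_pi -quo_piD scalerDr.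
Qed.
Fact quo_scaleDl u : {morph quo_scale^~ u : a b / a + b}.
Proof.
by move=> a b; rewrite -[u]quo_pi_repr !quo_scale_pi -quo_piD scalerDl.
Qed.

HB.instance Definition _ := GRing.Zmodule_isLmodule.Build R quomod
  quo_scaleA quo_scale1 quo_scaleDr quo_scaleDl.

Fact quo_pi_is_linear : linear quo_pi.
Proof. by move=> a x y; rewrite quo_piD -quo_scale_pi. Qed.
HB.instance Definition _ := GRing.isLinear.Build R V quomod _ quo_pi
  quo_pi_is_linear.

End Quotient.

Definition zero_sub : {pred V} := pred1 0.

Fact zero_sub_closed : submod_closed zero_sub.
Proof.
split=> [|a x y]; rewrite ?inE ?eqxx // => /eqP-> /eqP->.
by rewrite scaler0 addr0.
Qed.
HB.instance Definition _ := GRing.isSubmodClosed.Build R V zero_sub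
  zero_sub_closed.

Definition lspan (G : V -> Prop) : {pred V} := fun v =>
  `[< exists s : seq (R * V),
        (forall p, p \in s -> G p.2) /\ v = \sum_(p <- s) p.1 *: p.2 >].

Fact lspan_closed G : submod_closed (lspan G).
Proof.
split=> [|a x y /asboolP[s [sG ->]] /asboolP[t [tG ->]]]; apply/asboolP.
  by exists [::]; rewrite big_nil.
exists ([seq (a * p.1, p.2) | p <- s] ++ t); split=> [p|].
  by rewrite mem_cat => /orP[/mapP[q /sG ? ->]|/tG].
rewrite big_cat big_map scaler_sumr; congr (_ + _).
by apply: eq_bigr => p _; rewrite scalerA.
Qed.
HB.instance Definition _ G := GRing.isSubmodClosed.Build R V (lspan G)
  (lspan_closed G).

Lemma mem_lspan (G : V -> Prop) v : G v -> v \in lspan G.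
Proof.
move=> Gv; apply/asboolP; exists [:: (1, v)]; rewrite big_seq1 scale1r.
by split=> // p; rewrite inE => /eqP->.
Qed.

End Submodule.

Section LinearMaps.
Variable R : comPzRingType.
Implicit Types U V W : lmodType R.

Definition preim_sub V W (f : {linear V -> W}) (S : submodClosed W) :
  {pred V} := fun v => f v \in S.

Fact preim_sub_closed V W (f : {linear V -> W}) (S : submodClosed W) :
  submod_closed (preim_sub f S).
Proof.
split=> [|a x y xS yS]; rewrite unfold_in /preim_sub ?linear0 ?rpred0 //.
by rewrite linearP rpredD ?rpredZ.
Qed.
HB.instance Definition _ V W (f : {linear V -> W}) (S : submodClosed W) :=
  GRing.isSubmodClosed.Build R V (preim_sub f S) (preim_sub_closed f S).

Definition ker_sub V W (f : {linear V -> W}) : {pred V} := fun v => f v == 0.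

Fact ker_sub_closed V W (f : {linear V -> W}) : submod_closed (ker_sub f).
Proof.
split=> [|a x y /eqP fx /eqP fy]; rewrite unfold_in /ker_sub ?linear0 //.
by rewrite linearP fx fy scaler0 addr0.
Qed.
HB.instance Definition _ V W (f : {linear V -> W}) :=
  GRing.isSubmodClosed.Build R V (ker_sub f) (ker_sub_closed f).

Definition im_sub V W (f : {linear V -> W}) : {pred W} :=
  fun w => `[< exists v, f v = w >].

Fact im_sub_closed V W (f : {linear V -> W}) : submod_closed (im_sub f).
Proof.
split=> [|a _ _ /asboolP[x <-] /asboolP[y <-]]; apply/asboolP.
  by exists 0; rewrite linear0.
by exists (a *: x + y); rewrite linearP.
Qed.
HB.instance Definition _ V W (f : {linear V -> W}) :=
  GRing.isSubmodClosed.Build R W (im_sub f) (im_sub_closed f).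

Lemma lspan_sub V W (f : {linear V -> W}) (G : V -> Prop)
    (S : submodClosed W) :
  (forall v, G v -> f v \in S) -> forall v, v \in lspan G -> f v \in S.
Proof.
move=> GS _ /asboolP[s [sG ->]]; rewrite linear_sum big_seq rpred_sum // => p.
by move=> /sG/GS; rewrite linearZ => ?; rewrite rpredZ.
Qed.

Section SubMap.
Variables (V W : lmodType R) (f : {linear V -> W}).
Variables (S : submodClosed V) (T : submodClosed W).
Hypothesis fST : forall v, v \in S -> f v \in T.

Definition sub_map (x : submod S) : submod T :=
  Submod (fST (submod_valP x)).

Fact sub_map_is_linear : linear sub_map.
Proof. by move=> a x y; apply/val_inj; rewrite /= linearP. Qed.
HB.instance Definition _ := GRing.isLinear.Build R (submod S) (submod T) _
  sub_map sub_map_is_linear.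

(* The well-definedness proof is an argument so that the canonical linear
   structure below can be inferred. *)
Definition quo_map of (forall v, v \in S -> f v \in T) :=
  fun u : quomod S => quo_pi T (f (repr u)).

Lemma quo_map_pi v : quo_map fST (quo_pi S v) = quo_pi T (f v).
Proof. by apply/quo_piP; rewrite -linearB fST // quo_repr_pi. Qed.

Fact quo_map_is_linear : linear (quo_map fST).
Proof.
move=> a u v; rewrite -[u]quo_pi_repr -[v]quo_pi_repr -linearP.
by rewrite !quo_map_pi -linearP linearP.
Qed.
HB.instance Definition _ := GRing.isLinear.Build R (quomod S) (quomod T) _
  (quo_map fST) quo_map_is_linear.

End SubMap.

(* [Z / (Z ∩ B)]; it is only used with [B] contained in [Z]. *)
Definition subquot V (Z B : submodClosed V) : lmodType R :=
  quomod (preim_sub (val : {linear submod Z -> V}) B).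

Section SubquotMap.
Variables (V W : lmodType R) (f : {linear V -> W}).
Variables (Z B : submodClosed V) (Z' B' : submodClosed W).
Hypothesis fZ : forall v, v \in Z -> f v \in Z'.
Hypothesis fB : forall v, v \in B -> f v \in B'.

Fact subquot_map_subproof (x : submod Z) :
  x \in preim_sub (val : {linear submod Z -> V}) B ->
  sub_map fZ x \in preim_sub (val : {linear submod Z' -> W}) B'.
Proof. exact: fB. Qed.

Definition subquot_map : {linear subquot Z B -> subquot Z' B'} :=
  quo_map subquot_map_subproof.

End SubquotMap.

Definition lmod_iso V W : Prop := exists f : {linear V -> W}, bijective f.

End LinearMaps.

Section Tensor.
Variables (R : comPzRingType) (M : lmodType R) (K : choiceType).

(* The finitely supported functions [K -> M], with [<< m *g x >>] standing for
   the pure tensor [m ⊗ x].  A copy of [{malg M[K]}] is needed because the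
   scaling of the latter is by the coefficients. *)
Definition tens : Type := {malg M[K]}.
HB.instance Definition _ := GRing.Zmodule.on tens.

Fact tens_key : unit. Proof. by []. Qed.

(* Locked, like [tlift] below, since otherwise rewriting rules for big
   operators find the sum inside it. *)
Definition tens_scale : R -> tens -> tens := locked_with tens_key
  (fun a c => \sum_(x <- msupp c) << a *: c@_x *g x >>).

Lemma tens_scaleE a c x : (tens_scale a c)@_x = a *: c@_x.
Proof.
rewrite /tens_scale unlock raddf_sum /=; have [xc|xc] := boolP (x \in msupp c).
  rewrite (big_fsetD1 x) //= mcoeffUU big1_fset ?addr0 // => y.
  by rewrite !inE mcoeffU => /andP[/negPf->].
rewrite (mcoeff_outdom xc) scaler0 big1_fset // => y yc _.
by rewrite mcoeffU; case: eqP => // yx; rewrite -yx yc in xc.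
Qed.

Fact tens_scaleA a b c : tens_scale a (tens_scale b c) = tens_scale (a * b) c.
Proof. by apply/malgP => x; rewrite !tens_scaleE scalerA. Qed.
Fact tens_scale1 : left_id 1 tens_scale.
Proof. by move=> c; apply/malgP => x; rewrite tens_scaleE scale1r. Qed.
Fact tens_scaleDr : right_distributive tens_scale +%R.
Proof.
by move=> a c c'; apply/malgP => x; rewrite !(tens_scaleE, mcoeffD) scalerDr.
Qed.
Fact tens_scaleDl c : {morph tens_scale^~ c : a b / a + b}.
Proof.
by move=> a b; apply/malgP => x; rewrite !(tens_scaleE, mcoeffD) scalerDl.
Qed.
HB.instance Definition _ := GRing.Zmodule_isLmodule.Build R tens
  tens_scaleA tens_scale1 tens_scaleDr tens_scaleDl.

Definition tcoef (x : K) (c : tens) : M := c@_x.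
Fact tcoef_is_linear x : linear (tcoef x).
Proof. by move=> a c c'; rewrite /tcoef mcoeffD tens_scaleE. Qed.
HB.instance Definition _ x := GRing.isLinear.Build R tens M _ (tcoef x)
  (tcoef_is_linear x).

Definition pure (x : K) (m : M) : tens := << m *g x >>.
Fact pure_is_linear x : linear (pure x).
Proof.
move=> a m m'; apply/malgP => y.
by rewrite mcoeffD tens_scaleE !mcoeffU mulrnDl scalerMnr.
Qed.
HB.instance Definition _ x := GRing.isLinear.Build R M tens _ (pure x)
  (pure_is_linear x).

Lemma tensE (c : tens) : c = \sum_(x <- msupp c) pure x (tcoef x c).
Proof. exact: monalgE. Qed.

Variable N : lmodType R.

Definition tlift : (K -> {linear M -> N}) -> tens -> N := locked_with tens_key
  (fun f c => \sum_(x <- msupp c) f x (tcoef x c)).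

Lemma tliftEw f (c : tens) (D : {fset K}) : (msupp c `<=` D)%fset ->
  tlift f c = \sum_(x <- D) f x (tcoef x c).
Proof.
move=> cD; rewrite /tlift unlock [RHS](big_fsetID _ (mem (msupp c))) /= [X in _ + X]big1_fset.
  rewrite addr0; apply: eq_fbigl => x; rewrite !inE /=.
  by case: (boolP (x \in msupp c)) => [/(fsubsetP cD)->|]; rewrite ?andbF.
move=> x; rewrite !inE => /andP[_ xc] _.
by rewrite /tcoef mcoeff_outdom ?linear0.
Qed.

Fact tlift_is_linear f : linear (tlift f).
Proof.
move=> a c c'; set D := (msupp c `|` msupp c' `|` msupp (a *: c + c'))%fset.
rewrite !(@tliftEw f _ D) ?fsubsetUr //; first last.
- by rewrite /D -fsetUA fsubsetUl.
- by rewrite /D fsetUAC fsubsetUr.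
by rewrite scaler_sumr -big_split; apply: eq_bigr => x _; rewrite !linearP.
Qed.
HB.instance Definition _ f := GRing.isLinear.Build R tens N _ (tlift f)
  (tlift_is_linear f).

Lemma tlift_pure f x m : tlift f (pure x m) = f x m.
Proof.
rewrite (@tliftEw _ _ [fset x]%fset) ?msuppU_le // big_seq_fset1.
by rewrite /tcoef mcoeffUU.
Qed.

Lemma tens_ext (f g : {linear tens -> N}) :
  (forall x m, f (pure x m) = g (pure x m)) -> f =1 g.
Proof.
by move=> fg c; rewrite (tensE c) !linear_sum; apply: eq_bigr => x _.
Qed.

End Tensor.

Section Complexes.
Variable R : comPzRingType.

Record complex := Complex {
  cx_obj :> nat -> lmodType R;
  cx_d : forall n, {linear cx_obj n.+1 -> cx_obj n};
  cx_dd : forall n x, cx_d n (cx_d n.+1 x) = 0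
}.

(* Zero out of degree [0]. *)
Definition cx_out (C : complex) n : {linear C n -> C n.-1} :=
  if n is m.+1 then cx_d C m else \0.

(* The homology at [V] of [U -f-> V -g-> W]. *)
Definition homology3 (U V W : lmodType R)
    (f : {linear U -> V}) (g : {linear V -> W}) : lmodType R :=
  subquot (ker_sub g) (im_sub f).

Definition homology (C : complex) (n : nat) : lmodType R :=
  homology3 (cx_d C n) (cx_out C n).

Definition zero_lmod : lmodType R := 'rV[R]_0.

Definition homologyz (C : complex) (n : int) : lmodType R :=
  if n is Posz m then homology C m else zero_lmod.

Section SubQuotientComplex.
Variables (C : complex) (D : forall n, submodClosed (C n)).
Hypothesis dD : forall n x, x \in D n.+1 -> cx_d C n x \in D n.

Definition sub_complex : complex.
Proof.
apply: (@Complex (fun n => submod (D n)) (fun n => sub_map (@dD n))) => n x.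
by apply: val_inj; rewrite /= cx_dd.
Defined.

Definition quo_complex : complex.
Proof.
apply: (@Complex (fun n => quomod (D n)) (fun n => quo_map (@dD n))) => n x.
by rewrite -[x]quo_pi_repr /= !quo_map_pi cx_dd linear0.
Defined.

End SubQuotientComplex.

End Complexes.

Record multispindle (r : nat) := Multispindle {
  ms_set :> choiceType;
  ms_op : 'I_r -> ms_set -> ms_set -> ms_set;
  ms_idem : forall i x, ms_op i x x = x;
  ms_distr : forall i j x y z,
    ms_op j (ms_op i x y) z = ms_op i (ms_op j x z) (ms_op j y z)
}.

Section Actions.
Variables (R : comPzRingType) (r : nat) (X : multispindle r).

(* [act k x m] is [m ⋆_k x]. *)
Record action (M : lmodType R) := Action {
  act :> 'I_r -> X -> {linear M -> M};
  act_distr : forall i j x y m,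
    act j y (act i x m) = act i (ms_op j x y) (act j y m)
}.

Section HomologyAction.
Variables (C : complex R) (B : forall n, action (C n)).
Hypothesis cx_d_act : forall n i y c,
  cx_d C n (B n.+1 i y c) = B n i y (cx_d C n c).

Fact act_ker n i y c :
  c \in ker_sub (cx_out C n) -> B n i y c \in ker_sub (cx_out C n).
Proof.
rewrite !unfold_in /ker_sub; case: n c => [//|n] c /= /eqP dc.
by rewrite cx_d_act dc linear0.
Qed.

Fact act_im n i y c :
  c \in im_sub (cx_d C n) -> B n i y c \in im_sub (cx_d C n).
Proof.
move=> /asboolP[b <-]; apply/asboolP; exists (B n.+1 i y b).
exact: cx_d_act.
Qed.

Definition homology_action n : action (homology C n).
Proof.
apply: (@Action (homology C n)
  (fun i y => subquot_map (@act_ker n i y) (@act_im n i y))) => i j x y u.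
rewrite -[u]quo_pi_repr /= !quo_map_pi; congr quo_pi; apply: val_inj.
exact: act_distr.
Defined.

Definition zero_action : action (zero_lmod R).
Proof. by apply: (@Action _ (fun _ _ => \0)). Defined.

Definition homologyz_action (n : int) : action (homologyz C n) :=
  match n with Posz m => homology_action m | Negz _ => zero_action end.

End HomologyAction.

(* [x : {ffun 'I_n.+1 -> X}] is the sequence [(x n, ..., x 0)]. *)
Definition face n (k : 'I_r) (i : 'I_n.+2) (x : {ffun 'I_n.+2 -> X}) :
    {ffun 'I_n.+1 -> X} :=
  [ffun j : 'I_n.+1 =>
    if (j < i)%N then x (lift i j) else ms_op k (x (lift i j)) (x i)].

Lemma faceE n k i (x : {ffun 'I_n.+2 -> X}) (j : 'I_n.+1) :
  face k i x j =
    if (j < i)%N then x (inord j) else ms_op k (x (inord j.+1)) (x i).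
Proof.
have jn : (j < n.+1)%N := ltn_ord j.
rewrite ffunE; case: ltnP => ij; [|congr (ms_op _ _ _)]; congr (x _);
  apply/val_inj; rewrite /= inordK /bump ?ij //.
  by rewrite leqNgt ij.
exact: ltnW.
Qed.

Definition seq_act n (k : 'I_r) (y : X) (x : {ffun 'I_n.+1 -> X}) :
    {ffun 'I_n.+1 -> X} :=
  [ffun j => ms_op k (x j) y].

Definition degenerate n (x : {ffun 'I_n.+1 -> X}) : Prop :=
  exists i : 'I_n, x (widen_ord (leqnSn n) i) = x (lift ord0 i).

Section Chains.
Variable M : lmodType R.

Definition chain n : lmodType R := tens M {ffun 'I_n.+1 -> X}.

Definition degenerate_sub n : submodClosed (chain n) :=
  lspan (fun c : chain n => exists (x : {ffun 'I_n.+1 -> X}) (m : M),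
                   degenerate x /\ c = pure x m).

Variables (A : action M) (a : 'I_r -> R).

Definition dface n (k : 'I_r) (i : 'I_n.+2) : {linear chain n.+1 -> chain n} :=
  tlift (fun x => pure (face k i x) \o A k (x i)).

Definition bd n (c : chain n.+1) : chain n :=
  \sum_k a k *: \sum_(i < n.+2) (-1) ^+ (n.+1 - i) *: dface k i c.

Fact bd_is_linear n : linear (@bd n).
Proof.
move=> b c c'; rewrite /bd (scaler_sumr b) -big_split; apply: eq_bigr => k _.
rewrite /= (scalerA b) mulrC -(scalerA _ b) -scalerDr; congr (_ *: _).
rewrite scaler_sumr -big_split; apply: eq_bigr => i _.
by rewrite linearP scalerDr !scalerA [b * _]mulrC.
Qed.
HB.instance Definition _ n := GRing.isLinear.Build R (chain n.+1) (chain n) _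
  (@bd n) (@bd_is_linear n).

Lemma dface_pure n k (i : 'I_n.+2) x m :
  dface k i (pure x m) = pure (face k i x) (A k (x i) m).
Proof. exact: tlift_pure. Qed.

Lemma dface_dface n k l (i : 'I_n.+2) (j : 'I_n.+3) c : (i < j)%N ->
  dface k i (dface l j c) = dface l (inord j.-1) (dface k (inord i) c).
Proof.
move=> ij; have in3 : (i < n.+3)%N by rewrite ltnW // ltnS ltn_ord.
have jE : (j.-1.+1 = j)%N by rewrite prednK // (leq_ltn_trans _ ij).
have jn : (j.-1 < n.+2)%N by rewrite jE -ltnS ltn_ord.
pose f : {linear chain n.+2 -> chain n} := dface k i \o dface l j.
pose g : {linear chain n.+2 -> chain n} :=
  dface l (inord j.-1) \o dface k (inord i).
apply: (@tens_ext _ _ _ _ f g) => x m; rewrite /f /g /= !dface_pure.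
have ji : (j.-1 < i)%N = false by rewrite ltnNge -ltnS jE ij.
have -> : face k (inord i) x (inord j.-1) = ms_op k (x j) (x (inord i)).
  by rewrite faceE !inordK // ji jE inord_val.
have lji : face l j x i = x (inord i) by rewrite faceE ij.
rewrite lji act_distr; congr (pure _ _); apply/ffunP => t.
have t2 : (t < n.+2)%N by rewrite ltnW // ltnS ltn_ord.
have t3 : (t.+1 < n.+2)%N by rewrite ltnS ltn_ord.
rewrite !faceE !inordK // ij ji jE inord_val.
have [ti|it] := ltnP t i.
  have tj : (t < j.-1)%N by rewrite (leq_trans ti) // -ltnS jE.
  by rewrite tj (ltn_trans ti ij).
rewrite -[in (t.+1 < j)%N]jE ltnS; case: ltnP => // _.
by rewrite ltnNge ltnW // ms_distr.
Qed.

Lemma bd_bd n c : bd (bd c) = 0 :> chain n.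
Proof.
pose s (i : 'I_n.+2) : R := (-1) ^+ (n.+1 - i).
pose s' (j : 'I_n.+3) : R := (-1) ^+ (n.+2 - j).
pose F (q : 'I_r * 'I_r * ('I_n.+2 * 'I_n.+3)) : chain n :=
  (a q.1.1 * a q.1.2 * (s q.2.1 * s' q.2.2)) *:
    dface q.1.1 q.2.1 (dface q.1.2 q.2.2 c).
have -> : bd (bd c) = \sum_q F q.
  rewrite -(pair_bigA _ (fun kl ij => F (kl, ij))) /=.
  rewrite -(pair_bigA _ (fun k l => \sum_ij F ((k, l), ij))) /=.
  have Dbd k i : dface k i (bd c) =
      \sum_l \sum_j (a l * s' j) *: dface k i (dface l j c).
    rewrite (linear_sum (dface k i)); apply: eq_bigr => l _.
    rewrite linearZZ (linear_sum (dface k i)) scaler_sumr; apply: eq_bigr => j _.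
    by rewrite linearZZ scalerA.
  apply: eq_bigr => k _.
  transitivity (\sum_i \sum_l \sum_j F ((k, l), (i, j))).
    rewrite scaler_sumr; apply: eq_bigr => i _.
    rewrite -/(bd c) Dbd !scaler_sumr; apply: eq_bigr => l _.
    rewrite !scaler_sumr; apply: eq_bigr => j _.
    by rewrite !scalerA /F /= !mulrA; congr (_ * _ *: _); rewrite mulrAC.
  rewrite exchange_big; apply: eq_bigr => l _.
  by rewrite pair_bigA; apply: eq_bigr => -[].
pose T : finType := ('I_r * 'I_r * ('I_n.+2 * 'I_n.+3))%type.
pose P (q : T) := (q.2.1 < q.2.2)%N.
pose h (q : T) : T := ((q.1.2, q.1.1), (inord q.2.2, inord q.2.1.+1)).
pose h' (q : T) : T := ((q.1.2, q.1.1), (inord q.2.2.-1, inord q.2.1)).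
rewrite (bigID P) /= (reindex_onto h h') => [|[[k l] [i j]]]; last first.
  rewrite /P /h /h' /= => ij; have jE : (j.-1.+1 = j)%N.
    by rewrite prednK // (leq_ltn_trans _ ij).
  have jn : (j.-1 < n.+2)%N by rewrite jE -ltnS ltn_ord.
  have i3 : (i < n.+3)%N by rewrite ltnW // ltnS ltn_ord.
  by rewrite !inordK // jE !inord_val.
have hP (q : T) : P (h q) && (h' (h q) == q) = ~~ P q.
  case: q => [[k l] [i j]]; rewrite /P /h /h' /= -leqNgt.
  have i3 : (i.+1 < n.+3)%N by rewrite ltnS ltn_ord.
  rewrite (inordK i3) /= inord_val ltnS; have [ji|ij] := leqP j i.
    have j2 : (j < n.+2)%N by rewrite (leq_ltn_trans ji) ?ltn_ord.
    by rewrite inordK // ji inord_val eqxx.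
  apply/negP => /andP[hi /eqP[/(congr1 val)/= jE]].
  move: ij; rewrite -jE /= inordK ?ltnNge ?hi //.
  by rewrite ltnW // ltnS (leq_ltn_trans hi) ?ltn_ord.
rewrite (eq_bigl _ _ hP) -big_split big1 // => -[[k l] [i j]].
rewrite /P /F /h /= -leqNgt => ji.
have j2 : (j < n.+2)%N by rewrite (leq_ltn_trans ji) ?ltn_ord.
have i3 : (i.+1 < n.+3)%N by rewrite ltnS ltn_ord.
rewrite dface_dface ?inordK //= !inord_val -scalerDl [a l * _]mulrC -mulrDr.
suff -> : s (inord j) * s' (inord i.+1) + s i * s' j = 0.
  by rewrite mulr0 scale0r.
rewrite /s /s' !inordK // subSS (@subSn j n.+1) // exprS mulN1r mulrN.
by rewrite [X in X + _]mulrC subrr.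
Qed.

Lemma face_seq_act n k l y (i : 'I_n.+2) (x : {ffun 'I_n.+2 -> X}) :
  face k i (seq_act l y x) = seq_act l y (face k i x).
Proof. by apply/ffunP => j; rewrite !ffunE; case: ifP => // _; rewrite [RHS]ms_distr. Qed.

Lemma bd_degenerate n c :
  c \in degenerate_sub n.+1 -> bd c \in degenerate_sub n.
Proof.
apply: (@lspan_sub _ _ _ (@bd n)) => _ [x [m [[p xp] ->]]].
rewrite rpred_sum // => k _; rewrite rpredZ //.
have pn : (p < n.+2)%N by rewrite ltnW // ltnS ltn_ord.
have p1n : (p.+1 < n.+2)%N by rewrite ltnS ltn_ord.
pose i0 : 'I_n.+2 := Ordinal pn; pose i1 : 'I_n.+2 := Ordinal p1n.
have xi : x i0 = x i1.
  by move: xp; congr (x _ = x _); apply/val_inj.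
have i10 : i1 != i0 by rewrite -val_eqE /= neq_ltn ltnSn orbT.
rewrite (bigD1 i0) //= (bigD1 i1) //= addrA rpredD //.
  have p_n : (p <= n)%N by rewrite -ltnS ltn_ord.
  rewrite !dface_pure -xi subSS subSn // exprS mulN1r scaleNr.
  rewrite (_ : face k i1 x = face k i0 x) ?addNr ?rpred0 //.
  apply/ffunP => j; rewrite !faceE /= -xi ltnS leq_eqVlt.
  have [jp|jp|jp] /= := ltngtP j p => //.
  have -> : inord j = i0 by apply/val_inj; rewrite /= jp inordK.
  have -> : inord j.+1 = i1 by apply/val_inj; rewrite /= jp inordK.
  by rewrite -xi ms_idem.
rewrite rpred_sum // => i /andP[ii0 ii1]; rewrite rpredZ // dface_pure.
apply: mem_lspan; exists (face k i x), (A k (x i) m); split=> //.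
have [ip|pi|ip] := ltngtP i p; last by rewrite -val_eqE /= ip eqxx in ii0.
  have pE : (p.-1.+1 = p)%N by rewrite prednK // (leq_ltn_trans _ ip).
  have qn : (p.-1 < n)%N by rewrite -ltnS pE ltn_ord.
  exists (Ordinal qn); rewrite !faceE /= /bump /= add1n pE.
  rewrite (leqNgt p) ip ltnNge (ltnW ip) /=; congr (ms_op _ _ _).
  have -> : inord p = i0 by apply/val_inj; rewrite /= inordK.
  by rewrite xi; congr (x _); apply/val_inj; rewrite /= inordK.
have p1i : (p.+1 < i)%N.
  by rewrite ltn_neqAle pi andbT eq_sym; rewrite -val_eqE /= in ii1.
have qn : (p < n)%N by rewrite -ltnS (leq_trans p1i) // -ltnS ltn_ord.
exists (Ordinal qn); rewrite !faceE /= /bump /= add1n pi p1i.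
have -> : inord p = i0 by apply/val_inj; rewrite /= inordK.
by rewrite xi; congr (x _); apply/val_inj; rewrite /= inordK.
Qed.

Definition chain_complex : complex R :=
  Complex (cx_obj := chain) (cx_d := fun n => @bd n) bd_bd.

Definition degenerate_complex : complex R :=
  sub_complex (C := chain_complex) bd_degenerate.

Definition normalized_complex : complex R :=
  quo_complex (C := chain_complex) bd_degenerate.

Definition compound (x : X) (m : M) : M := \sum_k a k *: A k x m.

Fact compound_is_linear x : linear (compound x).
Proof.
move=> b m m'; rewrite /compound (scaler_sumr b) -big_split.
apply: eq_bigr => k _; rewrite linearP scalerDr !scalerA.
by rewrite [b * _]mulrC.
Qed.
HB.instance Definition _ x := GRing.isLinear.Build R M M _ (compound x)
  (compound_is_linear x).

Definition aug : {linear chain 0 -> M} := 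
  tlift (fun x : {ffun 'I_1 -> X} => compound (x ord0)).

Lemma aug_pure x m : aug (pure x m) = compound (x ord0) m.
Proof. exact: tlift_pure. Qed.

Lemma aug_bd c : aug (bd c) = 0.
Proof.
pose f : {linear chain 1 -> M} := aug \o @bd 0.
apply: (@tens_ext _ _ _ _ f \0) => x m; rewrite /f /= /bd (linear_sum aug) /=.
have x1E : inord 1 = ord_max :> 'I_2 by apply/val_inj; rewrite /= inordK.
have x0E : inord 0 = ord0 :> 'I_2 by apply/val_inj; rewrite /= inordK.
pose G k l := (a k * a l) *: A l (x ord0) (A k (x ord_max) m).
transitivity (\sum_k \sum_l (G k l - G l k)); last first.
  under eq_bigr do rewrite sumrB.
  by rewrite sumrB [X in _ - X]exchange_big subrr.
apply: eq_bigr => k _; rewrite big_ord_recl big_ord1 /= expr1 expr0 scale1r.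
have -> : lift ord0 ord0 = ord_max :> 'I_2 by apply/val_inj.
rewrite scaleN1r !dface_pure (linearZZ aug) (linearD aug) (linearN aug).
rewrite !aug_pure !faceE /= x0E x1E addrC /compound -sumrB scaler_sumr.
apply: eq_bigr => l _; rewrite -scalerBr scalerA scalerBr /G.
by rewrite [a l * _]mulrC -act_distr.
Qed.

Definition chain_act n (k : 'I_r) (y : X) : {linear chain n -> chain n} :=
  tlift (fun x => pure (seq_act k y x) \o A k y).

Lemma chain_act_pure n k y (x : {ffun 'I_n.+1 -> X}) m :
  chain_act n k y (pure x m) = pure (seq_act k y x) (A k y m).
Proof. exact: tlift_pure. Qed.

Fact chain_act_distr n i j x y (c : chain n) :
  chain_act n j y (chain_act n i x c) =
  chain_act n i (ms_op j x y) (chain_act n j y c).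
Proof.
pose f : {linear chain n -> chain n} := chain_act n j y \o chain_act n i x.
pose g : {linear chain n -> chain n} :=
  chain_act n i (ms_op j x y) \o chain_act n j y.
apply: (@tens_ext _ _ _ _ f g) => s m; rewrite /f /g /= !chain_act_pure.
rewrite act_distr; congr (pure _ _); apply/ffunP => t.
by rewrite !ffunE ms_distr.
Qed.

Definition chain_action n : action (chain n) := Action (@chain_act_distr n).

Lemma bd_chain_act n k y c :
  bd (chain_act n.+1 k y c) = chain_act n k y (bd c).
Proof.
pose f : {linear chain n.+1 -> chain n} := @bd n \o chain_act n.+1 k y.
pose g : {linear chain n.+1 -> chain n} := chain_act n k y \o @bd n.
apply: (@tens_ext _ _ _ _ f g) => s m; rewrite /f /g /= chain_act_pure.
rewrite /bd (linear_sum (chain_act n k y)); apply: eq_bigr => l _.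
rewrite linearZZ (linear_sum (chain_act n k y)); congr (_ *: _).
apply: eq_bigr => i _; rewrite linearZZ !dface_pure chain_act_pure.
by rewrite face_seq_act [seq_act k y s i]ffunE -act_distr.
Qed.

Lemma aug_chain_act k y c : aug (chain_act 0 k y c) = A k y (aug c).
Proof.
pose f : {linear chain 0 -> M} := aug \o chain_act 0 k y.
pose g : {linear chain 0 -> M} := A k y \o aug.
apply: (@tens_ext _ _ _ _ f g) => s m; rewrite /f /g /= chain_act_pure.
rewrite !aug_pure /compound (linear_sum (A k y)); apply: eq_bigr => l _.
by rewrite linearZZ ffunE -act_distr.
Qed.

(* Shifted by one: degree [n] here is degree [n - 1] of the augmented complex,
   so that [M] sits in degree [0]. *)
Definition aug_obj (n : nat) : lmodType R :=
  if n is m.+1 then chain m else M.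

Definition aug_d (n : nat) : {linear aug_obj n.+1 -> aug_obj n} :=
  match n with 0 => aug | m.+1 => @bd m end.

Fact aug_dd n x : aug_d n (aug_d n.+1 x) = 0.
Proof. by case: n x => [|n] x; [exact: aug_bd | exact: bd_bd]. Qed.

Definition aug_complex : complex R := Complex aug_dd.

Definition aug_action (n : nat) : action (aug_complex n) :=
  match n with 0 => A | m.+1 => chain_action m end.

Fact aug_d_act n i y c :
  cx_d aug_complex n (aug_action n.+1 i y c) =
  aug_action n i y (cx_d aug_complex n c).
Proof.
by case: n c => [|n] c; [exact: aug_chain_act | exact: bd_chain_act].
Qed.

Definition HD (n : nat) : lmodType R := homology degenerate_complex n.

Definition HN (n : int) : lmodType R := homologyz normalized_complex n.

Definition Hhat (n : int) : lmodType R := homologyz aug_complex (n + 1).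

Definition Hhat_action (n : int) : action (Hhat n) :=
  homologyz_action aug_d_act (n + 1).

End Chains.
End Actions.

Section SpectralSequences.
Variable R : comPzRingType.

(* Pages start at [r = 1]; page [0] is unconstrained.  To avoid casts,
   [ss_d r p q p' q'] is the component of the differential of the page [r] from
   bidegree [(p, q)] to bidegree [(p', q')]. *)
Record spectral_sequence := SpectralSequence {
  ss_page :> nat -> int -> int -> lmodType R;
  ss_d : forall (r : nat) (p q p' q' : int),
    {linear ss_page r p q -> ss_page r p' q'};
  ss_quadrant : forall (r : nat) (p q : int), (0 < r)%N -> p < 0 \/ q < 0 ->
    forall x : ss_page r p q, x = 0;
  ss_bidegree : forall (r : nat) (p q p' q' : int), (0 < r)%N ->
    (p', q') != (p - r%:Z, q + r%:Z - 1) ->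
    forall x, ss_d r p q p' q' x = 0;
  ss_dd : forall (r : nat) (p q p' q' p'' q'' : int), (0 < r)%N ->
    forall x, ss_d r p' q' p'' q'' (ss_d r p q p' q' x) = 0;
  ss_next : forall (r : nat) (p q : int), (0 < r)%N ->
    lmod_iso (ss_page r.+1 p q)
      (homology3 (ss_d r (p + r%:Z) (q - r%:Z + 1) p q)
                 (ss_d r p q (p - r%:Z) (q + r%:Z - 1)))
}.

(* For [r > max(p, q + 1)] the differentials of the page [r] into and out of
   bidegree [(p, q)] vanish, so the pages are stationary there. *)
Definition ss_infty (E : spectral_sequence) (p q : nat) : lmodType R :=
  E (maxn p q.+1).+1 p%:Z q%:Z.

Definition prev_sub (V : lmodType R) (F : nat -> submodClosed V) (p : nat) :
    submodClosed V :=
  if p is p'.+1 then F p' else @zero_sub R V.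

Definition converges (E : spectral_sequence) (H : nat -> lmodType R) : Prop :=
  exists F : forall n, nat -> submodClosed (H n),
    [/\ forall n p x, x \in F n p -> x \in F n p.+1,
        forall n, exists p, forall x, x \in F n p
      & forall p q, lmod_iso (ss_infty E p q)
                      (subquot (F (p + q)%N p) (prev_sub (F (p + q)%N) p))].

End SpectralSequences.

(* Main.v *)
(** Filter the degenerate chains by the position of the first repetition
    [x_i = x_(i+1)].  Modulo earlier repetitions a generator with first
    repetition at [p] is [(y, x_p, x_p, x_(p-1), ..., x_0)] with
    [(x_p, ..., x_0)] nondegenerate.  The faces at the two copies of [x_p] cancel
    and those at [x_i], [i < p], lower the filtration, so [d^0] is the differential
    of the augmented complex on [y] and [E^1_pq] consists of the nondegenerate
    sequences with coefficients in its homology in degree [q - 2].  The faces at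
    [x_i], [i < p], then give [d^1]; it agrees up to sign with the differential of
    the normalized complex, whose remaining face at [x_p] vanishes because the
    compound action is null-homotopic on the augmented complex, through
    [c |-> (c, x_p)]. *)
From HB Require Import structures.
Require Import Defs.
From mathcomp Require Import all_boot all_order all_algebra finmap boolp.
From mathcomp Require Import monalg zify.

Set Implicit Arguments.
Unset Strict Implicit.
Unset Printing Implicit Defensive.

Import Order.TTheory GRing.Theory Num.Theory.
Local Open Scope ring_scope.

(** A chain of total degree p + q has p + q + 1 entries. The block (x_p, x_p, x_(p-1), ..., x_0)
    uses p + 2 of them, so q - 1 are left for y, which puts y in degree q - 2. For q = 1 nothing is
    left: y is a bare element of M, and its boundary group comes from one-entry tails. This is why
    the augmentation appears. Splitting a sequence into a block and a tail changes both lengths,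
    which is awkward with modules indexed by degree. So all degrees are put into one module of
    chains on lists with x_0 at the head: the block is then a prefix, and the empty tail carries M.
    The other obstacle is that a homology class has no canonical tail. Coefficients are first taken
    to be cycles, so that block-and-tail is an honest linear map [beta]. Passing to classes happens
    only when [beta] is compared with the normalized chains, both sides being quotients of the
    chains with cycle coefficients. *)

(** * Isomorphisms from linear relations, and representatives in subquotients *)

Section Relations.
Variable R : comPzRingType.

(** Applied to differences, the condition on zeros makes a linear relation single-valued in both
    directions. Subquotients can thus be compared through shared representatives, without first
    proving a map well defined. *)
Lemma lmod_iso_rel (V W : lmodType R) (S : V -> W -> Prop) :
  (forall a v w v' w', S v w -> S v' w' -> S (a *: v + v') (a *: w + w')) ->
  (forall v, exists w, S v w) -> (forall w, exists v, S v w) ->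
  (forall v w, S v w -> v = 0 <-> w = 0) -> lmod_iso V W.
Proof.
move=> Slin Stot Ssurj Szero.
have SB v w v' w' : S v w -> S v' w' -> S (v - v') (w - w').
  move=> vw vw'; have := Slin (- 1) _ _ _ _ vw' vw.
  by rewrite !scaleN1r ![- _ + _]addrC.
have [f fP] := choice Stot; have [g gP] := choice Ssurj.
have f_eq v w : S v w -> f v = w.
  by move=> /(SB _ _ _ _ (fP v))/Szero; rewrite subrr => -[/(_ erefl)/subr0_eq].
have g_eq v w : S v w -> g w = v.
  by move=> /(SB _ _ _ _ (gP w))/Szero; rewrite subrr => -[_ /(_ erefl)/subr0_eq].
have f_lin : linear f by move=> a v v'; apply/f_eq/Slin.
pose F : {linear V -> W} := HB.pack f (GRing.isLinear.Build R V W _ f f_lin).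
by exists F, g => [v|w]; [exact: g_eq | exact: f_eq].
Qed.

Lemma lmod_iso_trans (U V W : lmodType R) :
  lmod_iso U V -> lmod_iso V W -> lmod_iso U W.
Proof.
move=> [f bf] [g bg]; pose h : {linear U -> W} := g \o f.
by exists h; apply: bij_comp.
Qed.

Lemma submod_rpredN (V : lmodType R) (S : submodClosed V) x :
  x \in S -> - x \in S.
Proof. exact: submod_oppr_closed. Qed.

Lemma submod_rpredB (V : lmodType R) (S : submodClosed V) x y :
  x \in S -> y \in S -> x - y \in S.
Proof. by move=> xS yS; rewrite rpredD // submod_rpredN. Qed.

Section Represents.
Variables (V : lmodType R) (Z B : submodClosed V).

Definition represents (u : subquot Z B) (x : V) : Prop :=
  exists y : submod Z, val y = x /\ quo_pi _ y = u.

Lemma represents_mem u x : represents u x -> x \in Z.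
Proof. by move=> [y [<- _]]; apply: submod_valP. Qed.

Lemma represents_ex x : x \in Z -> exists u, represents u x.
Proof. by move=> xZ; exists (quo_pi _ (Submod xZ)), (Submod xZ). Qed.

Lemma ex_represents u : exists x, represents u x.
Proof. by exists (val (repr u : submod Z)), (repr u); rewrite quo_pi_repr. Qed.

Lemma represents_lin a u x v y :
  represents u x -> represents v y -> represents (a *: u + v) (a *: x + y).
Proof.
move=> [x' [<- <-]] [y' [<- <-]]; exists (a *: x' + y').
by rewrite !linearP.
Qed.

Lemma represents0 u x : represents u x -> u = 0 <-> x \in B.
Proof.
move=> [y [<- <-]]; rewrite -(linear0 (quo_pi _)).
by split=> [/quo_piP|yB]; [|apply/quo_piP]; rewrite subr0.
Qed.

Lemma represents_shift u x y :
  represents u x -> y \in Z -> y \in B -> represents u (x + y).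
Proof.
move=> ux yZ yB; have [v vy] := represents_ex yZ.
have v0 : v = 0 by apply/(represents0 vy).
have := represents_lin 1 vy ux; rewrite v0 scaler0 add0r scale1r addrC //.
Qed.

Lemma represents_inj u v x : represents u x -> represents v x -> u = v.
Proof.
move=> ux vx; have := represents_lin (-1) vx ux; rewrite !scaleN1r addNr addrC.
by move=> /represents0[_ /(_ (rpred0 _))/subr0_eq].
Qed.

End Represents.

Lemma represents_map (V W : lmodType R) (f : {linear V -> W})
    (Z B : submodClosed V) (Z' B' : submodClosed W)
    (fZ : forall v, v \in Z -> f v \in Z') (fB : forall v, v \in B -> f v \in B')
    (u : subquot Z B) x :
  represents u x -> represents (subquot_map fZ fB u) (f x).
Proof.
move=> [y [<- <-]]; exists (Defs.sub_map fZ y); split => //.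
by rewrite /subquot_map /= quo_map_pi.
Qed.

Section Homology3.
Variables (U V W : lmodType R) (f : {linear U -> V}) (g : {linear V -> W}).

Lemma represents_ker (h : homology3 f g) v : represents h v -> g v = 0.
Proof. by move/represents_mem => /eqP. Qed.

Lemma represents_im (h : homology3 f g) v :
  represents h v -> h = 0 <-> exists u, f u = v.
Proof. by move/represents0 ->; split=> /asboolP. Qed.

Lemma homology3_ex v : g v = 0 -> exists h : homology3 f g, represents h v.
Proof. by move=> gv; apply: represents_ex; apply/eqP. Qed.

End Homology3.

Lemma lmod_iso_zero (V W : lmodType R) :
  (forall v : V, v = 0) -> (forall w : W, w = 0) -> lmod_iso V W.
Proof.
move=> V0 W0; apply: (@lmod_iso_rel _ _ (fun _ _ => True)) => [|v|w|v w _].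
- by [].
- by exists 0.
- by exists 0.
- by split=> _; [exact: W0 | exact: V0].
Qed.

(** Only the middle modules are related. In the application at p = 0 the maps out of them end in
    modules that do not correspond, so an isomorphism of sequences would ask for too much. *)
Lemma homology3_iso (U V W U' V' W' : lmodType R)
    (f : {linear U -> V}) (g : {linear V -> W})
    (f' : {linear U' -> V'}) (g' : {linear V' -> W'}) (S : V -> V' -> Prop) :
  (forall a v w v' w', S v w -> S v' w' -> S (a *: v + v') (a *: w + w')) ->
  (forall v, exists w, S v w) -> (forall w, exists v, S v w) ->
  (forall v v', S v v' -> g v = 0 <-> g' v' = 0) ->
  (forall v v', S v v' -> (exists u, f u = v) <-> exists u, f' u = v') ->
  lmod_iso (homology3 f g) (homology3 f' g').
Proof.
move=> Slin Stot Ssurj Sker Sim.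
apply: (@lmod_iso_rel _ _ (fun h h' =>
  exists v v', [/\ S v v', represents h v & represents h' v'])).
- move=> a h h' k k' [v [v' [S1 r1 r1']]] [w [w' [S2 r2 r2']]].
  exists (a *: v + w), (a *: v' + w').
  by split; [exact: Slin | exact: represents_lin | exact: represents_lin].
- move=> h; have [v hv] := ex_represents h; have [v' Sv] := Stot v.
  have [h' h'v'] : exists h' : homology3 f' g', represents h' v'.
    by apply/homology3_ex/(Sker _ _ Sv)/(represents_ker hv).
  by exists h', v, v'.
- move=> h'; have [v' hv'] := ex_represents h'; have [v Sv] := Ssurj v'.
  have [h hv] : exists h : homology3 f g, represents h v.
    by apply/homology3_ex/(Sker _ _ Sv)/(represents_ker hv').
  by exists h, v, v'.
- move=> h h' [v [v' [Sv hv hv']]].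
  by rewrite (represents_im hv) (represents_im hv'); apply: Sim.
Qed.

End Relations.

(** * The spectral sequence of a filtered complex *)

(* [V] is the total module of the complex and [Fil p n] the part of total
   degree [n] of the [p]-th step of the filtration. *)
Section FilteredModule.
Variables (R : comPzRingType) (V : lmodType R) (D : {linear V -> V}).
Variable Fil : int -> int -> submodClosed V.
Hypothesis DD : forall x, D (D x) = 0.
Hypothesis Fil_le : forall (p p' n : int) x,
  p <= p' -> x \in Fil p n -> x \in Fil p' n.
Hypothesis Fil_neg : forall (p n : int) x, p < 0 -> x \in Fil p n -> x = 0.
Hypothesis Fil_top : forall (p n : int) x,
  n <= p -> x \in Fil p n -> x \in Fil (n - 1) n.

Lemma Fil_cast p p' n n' x :
  p = p' -> n = n' -> x \in Fil p n -> x \in Fil p' n'.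
Proof. by move=> -> ->. Qed.

(* [fz r p n] and [fb r p n] are the usual Z^r_p and B^r_p in degree [n]. *)
Definition fz (r p n : int) : {pred V} :=
  fun x => (x \in Fil p n) && (D x \in Fil (p - r) (n - 1)).

Fact fz_closed r p n : submod_closed (fz r p n).
Proof.
split=> [|c x y /andP[x1 x2] /andP[y1 y2]]; apply/andP.
  by rewrite linear0 !rpred0.
by rewrite linearP !rpredD ?rpredZ.
Qed.
HB.instance Definition _ r p n :=
  GRing.isSubmodClosed.Build R V (fz r p n) (fz_closed r p n).

Definition fb (r p n : int) : {pred V} := fun x =>
  `[< exists y z, [/\ y \in fz (r - 1) (p + r - 1) (n + 1),
                      z \in fz (r - 1) (p - 1) n & x = D y + z] >].

Fact fb_closed r p n : submod_closed (fb r p n).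
Proof.
split=> [|c x y /asboolP[x1 [x2 [h1 h2 ->]]] /asboolP[y1 [y2 [h3 h4 ->]]]].
  by apply/asboolP; exists 0, 0; split; rewrite ?rpred0 // linear0 addr0.
apply/asboolP; exists (c *: x1 + y1), (c *: x2 + y2).
by rewrite !rpredD ?rpredZ //; split=> //; rewrite linearP scalerDr addrACA.
Qed.
HB.instance Definition _ r p n :=
  GRing.isSubmodClosed.Build R V (fb r p n) (fb_closed r p n).

Lemma fzP r p n x :
  reflect (x \in Fil p n /\ D x \in Fil (p - r) (n - 1)) (x \in fz r p n).
Proof. exact: andP. Qed.

Lemma fbP r p n x :
  reflect (exists y z, [/\ y \in fz (r - 1) (p + r - 1) (n + 1),
                      z \in fz (r - 1) (p - 1) n & x = D y + z]) (x \in fb r p n).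
Proof. exact: asboolP. Qed.

Definition fpage (r : nat) (p q : int) : lmodType R :=
  subquot (fz r%:Z p (p + q) : submodClosed V) (fb r%:Z p (p + q)).

Lemma fd_fz (r : nat) (p q p' q' : int) :
  (p', q') = (p - r%:Z, q + r%:Z - 1) ->
  forall x, x \in fz r p (p + q) -> D x \in fz r p' (p' + q').
Proof.
move=> [-> ->] x /fzP[_ xD]; apply/fzP; rewrite DD rpred0; split=> //.
by apply: Fil_cast xD; clear; lia.
Qed.

Lemma fd_fb (r : nat) (p q p' q' : int) :
  (p', q') = (p - r%:Z, q + r%:Z - 1) ->
  forall x, x \in fb r p (p + q) -> D x \in fb r p' (p' + q').
Proof.
move=> [-> ->] _ /fbP[y [z [_ zZ ->]]]; rewrite linearD DD add0r.
apply/fbP; exists z, 0; rewrite rpred0 addr0; split=> //.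
by congr (_ \in fz _ _ _): zZ; clear; lia.
Qed.

(** The equation between bidegrees is decided classically, since its proof is what makes [D] fit the
    index types. Later arguments compute with [represents_fd]. *)
Definition fd (r : nat) (p q p' q' : int) :
    {linear fpage r p q -> fpage r p' q'} :=
  match pselect ((p', q') = (p - r%:Z, q + r%:Z - 1)) with
  | left e => subquot_map (fd_fz e) (fd_fb e)
  | right _ => \0
  end.

Lemma represents_fd (r : nat) (p q p' q' : int) (u : fpage r p q) x :
  (p', q') = (p - r%:Z, q + r%:Z - 1) ->
  represents u x -> represents (fd r p q p' q' u) (D x).
Proof.
move=> e ux; rewrite /fd; case: pselect => // e'.
exact: represents_map.
Qed.

(** For q <= 0 the degree p + q is at most p, so [Fil_top] already places the element in step p - 1,
    and it belongs to the Z^(r-1) summand of [fb]. The row q = 0 vanishes too. *)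
Lemma fpage_quadrant (r : nat) (p q : int) : (0 < r)%N -> p < 0 \/ q <= 0 ->
  forall u : fpage r p q, u = 0.
Proof.
move=> r0 pq u; have [x ux] := ex_represents u.
apply/(represents0 ux)/fbP; have /fzP[xF xD] := represents_mem ux.
exists 0, x; rewrite rpred0 linear0 add0r; split=> //; apply/fzP.
have [p0|p0] := ltP p 0.
  by rewrite (Fil_neg p0 xF) linear0 !rpred0.
have q0 : q <= 0 by lia.
split.
  have /Fil_top/(_ xF) : p + q <= p by clear -q0; lia.
  by apply: Fil_le; clear -q0; lia.
by apply: Fil_cast xD; clear; lia.
Qed.

(** The relation keeps the representative x. If d^r kills the class of x, then D x = D y + z with y
    in step p - 1 and z in step p - r - 1, so x - y represents the same class and lies in Z^(r+1).
    The neighbouring bidegrees are variables bound by equations to avoid casts. *)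
Lemma fpage_next (r : nat) (p q p1 q1 p2 q2 : int) : (0 < r)%N ->
  (p, q) = (p1 - r%:Z, q1 + r%:Z - 1) -> (p2, q2) = (p - r%:Z, q + r%:Z - 1) ->
  lmod_iso (fpage r.+1 p q) (homology3 (fd r p1 q1 p q) (fd r p q p2 q2)).
Proof.
move=> r0 e1 e2; have [e1p e1q] := e1; have [e2p e2q] := e2.
apply: (@lmod_iso_rel _ _ _ (fun (e : fpage r.+1 p q)
    (h : homology3 (fd r p1 q1 p q) (fd r p q p2 q2)) =>
  exists x (u : fpage r p q),
    [/\ represents e x, represents u x & represents h u])).
- move=> c e h e' h' [x [u [h1 h2 h3]]] [x' [u' [h1' h2' h3']]].
  by exists (c *: x + x'), (c *: u + u'); split; apply: represents_lin.
- move=> e; have [x ex] := ex_represents e; have /fzP[xF xD] := represents_mem ex.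
  have [u ux] : exists u : fpage r p q, represents u x.
    by apply/represents_ex/fzP; split=> //; apply: Fil_le xD; clear; lia.
  have [h hu] : exists h : homology3 (fd r p1 q1 p q) (fd r p q p2 q2),
      represents h u.
    apply: homology3_ex; apply/(represents0 (represents_fd e2 ux)).
    apply/fbP; exists 0, (D x); rewrite rpred0 linear0 add0r; split=> //.
    apply/fzP; rewrite DD rpred0; split=> //.
    by apply: Fil_cast xD; clear -e2p e2q; lia.
  by exists h, x, u.
- move=> h; have [u hu] := ex_represents h; have [x ux] := ex_represents u.
  have /fzP[xF xD] := represents_mem ux.
  have /represents0[/(_ (represents_ker hu)) + _] := represents_fd e2 ux.
  move=> /fbP[y [z [/fzP[yF yD] /fzP[zF _] Dx]]].
  have {}yF : y \in Fil (p - 1) (p + q).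
    by apply: Fil_cast yF; clear -e2p e2q; lia.
  have {}yD : D y \in Fil (p - r%:Z) (p + q - 1).
    by apply: Fil_cast yD; clear -e2p e2q; lia.
  have [e ex] : exists e : fpage r.+1 p q, represents e (x - y).
    apply/represents_ex/fzP; rewrite linearB Dx [D y + z]addrC addrK.
    split; first by apply: submod_rpredB xF _; apply: Fil_le yF; clear; lia.
    by apply: Fil_cast zF; clear -e2p e2q; lia.
  exists e, (x - y), u; split=> //; apply: represents_shift ux _ _.
    apply/submod_rpredN/fzP; split=> //; apply: Fil_le yF; clear; lia.
  apply/submod_rpredN/fbP; exists 0, y; rewrite rpred0 linear0 add0r; split=> //.
  by apply/fzP; split=> //; apply: Fil_cast yD; clear; lia.
- move=> e h [x [u [ex ux hu]]].
  have /fzP[xF xD] := represents_mem ex.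
  rewrite (represents_im hu) (represents0 ex); split.
    move=> /fbP[y [z [/fzP[yF yD] /fzP[zF zD] xE]]].
    have [v vy] : exists v : fpage r p1 q1, represents v y.
      apply/represents_ex/fzP; split.
        by apply: Fil_cast yF; clear -e1p e1q; lia.
      by apply: Fil_cast yD; clear -e1p e1q; lia.
    have {}zF : z \in Fil (p - 1) (p + q) by [].
    have {}zD : D z \in Fil (p - r%:Z - 1) (p + q - 1).
      by apply: Fil_cast zD; clear; lia.
    exists v; apply: (represents_inj _ ux); rewrite xE; apply: represents_shift.
    + exact: represents_fd vy.
    + by apply/fzP; split; [apply: Fil_le zF | apply: Fil_le zD]; clear; lia.
    + apply/fbP; exists 0, z; rewrite rpred0 linear0 add0r; split=> //.
      by apply/fzP; split=> //; apply: Fil_le zD; clear; lia.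
  move=> [v vu]; have [y vy] := ex_represents v.
  have /fzP[yF yD] := represents_mem vy.
  have {}yF : y \in Fil (p + r%:Z) (p + q + 1).
    by apply: Fil_cast yF; clear -e1p e1q; lia.
  have {}yD : D y \in Fil p (p + q) by apply: Fil_cast yD; clear -e1p e1q; lia.
  have := represents_fd e1 vy; rewrite vu => uDy.
  have := represents_lin (-1) uDy ux; rewrite !scaleN1r addNr [- D y + x]addrC.
  move=> /represents0[/(_ erefl) + _].
  move=> /fbP[y' [z [/fzP[y'F y'D] /fzP[zF zD] xE]]].
  (* Here y comes from the preimage under d^r, and y' from the boundaries already divided out in
     E^r. Since D z = D x, the remainder z satisfies the sharper condition of Z^r. *)
  apply/fbP; exists (y + y'), z; split.
  + apply/fzP; rewrite linearD; split.
      apply: rpredD; first by apply: Fil_cast yF; clear; lia.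
      by apply: Fil_le y'F; clear; lia.
    apply: rpredD; first by apply: Fil_cast yD; clear; lia.
    by apply: Fil_cast y'D; clear; lia.
  + apply/fzP; split=> //.
    have -> : D z = D x.
      by rewrite -[x](subrK (D y)) xE !linearD !DD add0r addr0.
    by apply: Fil_cast xD; clear; lia.
  + by rewrite linearD -addrA -xE addrC subrK.
Qed.

Fact fd_bidegree (r : nat) (p q p' q' : int) : (0 < r)%N ->
  (p', q') != (p - r%:Z, q + r%:Z - 1) -> forall x, fd r p q p' q' x = 0.
Proof. by move=> _ /eqP e x; rewrite /fd; case: pselect. Qed.

Fact fd_fd (r : nat) (p q p' q' p'' q'' : int) : (0 < r)%N ->
  forall x, fd r p' q' p'' q'' (fd r p q p' q' x) = 0.
Proof.
move=> r0 u.
have [e|/eqP e] := pselect ((p', q') = (p - r%:Z, q + r%:Z - 1)); last first.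
  by rewrite (fd_bidegree r0 e) linear0.
have [e'|/eqP e'] := pselect ((p'', q'') = (p' - r%:Z, q' + r%:Z - 1));
  last first.
  by rewrite (fd_bidegree r0 e').
have [x ux] := ex_represents u.
have := represents_fd e' (represents_fd e ux).
by rewrite DD => /represents0[_]; apply; rewrite rpred0.
Qed.

Definition filtered_ss : spectral_sequence R.
Proof.
apply: (@SpectralSequence R fpage fd) => //.
- by move=> r p q r0 pq; apply: fpage_quadrant r0 _; lia.
- exact: fd_bidegree.
- exact: fd_fd.
- move=> r p q r0; apply: fpage_next => //.
  by rewrite !(addrK, subrK) addrAC !(addrK, subrK).
Defined.

(** * Convergence to the homology of the union of the filtration *)

Section Convergence.
(** By [Fil_top], [Fil n n] is everything that the filtration has in degree n, so the hypotheses say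
    that H n is the homology of the union. A relation to representatives is used because H may come
    from another model of the complex. *)
Variables (H : nat -> lmodType R) (rep : forall n, H n -> V -> Prop).
Hypothesis rep_lin : forall n a u x v y,
  @rep n u x -> @rep n v y -> rep (a *: u + v) (a *: x + y).
Hypothesis ex_rep : forall n (u : H n), exists2 x, rep u x &
  x \in Fil n n /\ D x = 0.
Hypothesis rep_ex : forall n x, x \in Fil n%:Z n%:Z -> D x = 0 ->
  exists u : H n, rep u x.
Hypothesis rep0 : forall n (u : H n) x, rep u x ->
  u = 0 <-> exists2 y, y \in Fil n.+1%:Z n.+1%:Z & D y = x.

Definition hfil (n p : nat) : {pred H n} := fun u : H n =>
  `[< exists2 x, rep u x & x \in Fil p n /\ D x = 0 >].

Arguments hfil : clear implicits.

Lemma rep_zero n : @rep n 0 0.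
Proof.
have [u ux] : exists u : H n, rep u 0 by apply: rep_ex; rewrite ?rpred0 ?linear0.
have -> // : 0 = u; apply/esym/(rep0 ux).
by exists 0; rewrite ?rpred0 ?linear0.
Qed.

Fact hfil_closed n p : submod_closed (hfil n p).
Proof.
split=> [|c u v /asboolP[x ux [xF xD]] /asboolP[y vy [yF yD]]]; apply/asboolP.
  by exists 0; [exact: rep_zero | rewrite rpred0 linear0].
exists (c *: x + y); first exact: rep_lin.
by rewrite rpredD ?rpredZ // linearP xD yD scaler0 addr0.
Qed.
HB.instance Definition _ n p :=
  GRing.isSubmodClosed.Build R (H n) (hfil n p) (hfil_closed n p).

(** A uniform description of the previous step: at p = 0 it is zero because [Fil (-1) n] is. *)
Lemma prev_hfilP n p (u : H n) :
  u \in prev_sub (fun p => hfil n p : submodClosed (H n)) p <->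
  exists2 x, rep u x & x \in Fil (p%:Z - 1) n /\ D x = 0.
Proof.
case: p => [|p] /=; last first.
  have -> : p.+1%:Z - 1 = p by lia.
  by split=> /asboolP.
split=> [/eqP->|[x ux [xF _]]].
  by exists 0; [exact: rep_zero | rewrite rpred0 linear0].
apply/eqP/(rep0 ux); exists 0; rewrite ?rpred0 //.
by rewrite linear0 (Fil_neg _ xF).
Qed.

(** On the page r > max(p, q + 1), an element of Z^r has D x in step p - r < 0, so it is a cycle;
    and B^r draws on step p + r - 1 >= n + 1, hence on all chains of degree n + 1. *)
Lemma filtered_ss_converges : converges filtered_ss H.
Proof.
exists (fun n p => hfil n p : submodClosed (H n)); split.
- move=> n p u /asboolP[x ux [xF xD]]; apply/asboolP; exists x => //.
  by split=> //; apply: Fil_le xF; clear; lia.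
- by move=> n; exists n => u; apply/asboolP; apply: ex_rep.
move=> p q; set n := (p + q)%N; set r := (maxn p q.+1).+1.
have pr : (p < r)%N by rewrite ltnS leq_maxl.
have qr : (q.+1 < r)%N by rewrite ltnS leq_maxr.
have Fil_all m k x : m <= k -> x \in Fil k m -> x \in Fil m m.
  by move=> mk /(Fil_top mk); apply: Fil_le; clear; lia.
rewrite /ss_infty /= -/r.
pose Hn : nat -> submodClosed (H n) := fun p => hfil n p.
apply: (@lmod_iso_rel _ _ _ (fun (e : fpage r p q)
    (h : subquot (Hn p) (prev_sub Hn p)) => exists x u,
  [/\ represents e x, D x = 0, rep u x & represents h u])).
- move=> c e h e' h' [x [u [h1 h2 h3 h4]]] [x' [u' [h1' h2' h3' h4']]].
  exists (c *: x + x'), (c *: u + u'); split; try exact: represents_lin.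
    by rewrite linearP h2 h2' scaler0 addr0.
  exact: rep_lin.
- move=> e; have [x ex] := ex_represents e; have /fzP[xF] := represents_mem ex.
  move=> /Fil_neg; move=> /(_ ltac:(clear -pr qr; lia)) xD.
  have [u ux] : exists u : H n, rep u x.
    by apply: rep_ex => //; apply: Fil_le xF; clear -pr qr; lia.
  have [h hu] : exists h : subquot (Hn p) (prev_sub Hn p), represents h u.
    by apply/represents_ex/asboolP; exists x.
  by exists h, x, u.
- move=> h; have [u hu] := ex_represents h.
  have /asboolP[x ux [xF xD]] := represents_mem hu.
  have [e ex] : exists e : fpage r p q, represents e x.
    by apply/represents_ex/fzP; rewrite xD rpred0.
  by exists e, x, u.
- move=> e h [x [u [ex xD ux hu]]].
  rewrite (represents0 ex) (represents0 hu); rewrite prev_hfilP; split.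
    move=> /fbP[y [z [/fzP[yF _] /fzP[zF zD] xE]]].
    have Dz : D z = 0 by move: zD => /Fil_neg; apply; clear -pr qr; lia.
    exists z => //.
    have [v vz] : exists v : H n, rep v z.
      by apply: rep_ex => //; apply: Fil_le zF; clear -pr qr; lia.
    have -> // : u = v; apply/subr0_eq.
    have := rep_lin (-1) vz ux; rewrite !scaleN1r ![- _ + _]addrC xE addrK => uvy.
    apply/(rep0 uvy); exists y => //.
    apply: (@Fil_all _ (p%:Z + r%:Z - 1)); first by clear -pr qr; lia.
    by apply: Fil_cast yF; clear -pr qr; lia.
  move=> [z uz [zF zD]].
  have := rep_lin (-1) uz ux; rewrite !scaleN1r ![- _ + _]addrC subrr.
  move=> /rep0[/(_ erefl)[y yF yE] _].
  have Dy : D y \in Fil p n.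
    have /fzP[xF _] := represents_mem ex.
    by rewrite yE submod_rpredB //; apply: Fil_le zF; clear -pr qr; lia.
  apply/fbP; exists y, z; rewrite yE subrK; split=> //.
    apply/fzP; split.
      have : y \in Fil n.+1 (p%:Z + q%:Z + 1).
        by apply: Fil_cast yF; clear; lia.
      by apply: Fil_le; clear -pr qr; lia.
    by apply: Fil_cast Dy; clear -pr qr; lia.
  by apply/fzP; rewrite zD rpred0.
Qed.

End Convergence.
End FilteredModule.

(** * The total complex on lists *)

Section Support.
Variables (R : comPzRingType) (M : lmodType R) (K : choiceType).

Definition supp (P : pred K) : {pred tens M K} :=
  fun c => `[< forall x, ~~ P x -> tcoef x c = 0 >].

Fact supp_closed P : submod_closed (supp P).
Proof.
split=> [|c u v /asboolP u0 /asboolP v0]; apply/asboolP => x Px.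
  by rewrite linear0.
by rewrite linearP /= u0 // v0 // scaler0 addr0.
Qed.
HB.instance Definition _ P :=
  GRing.isSubmodClosed.Build R (tens M K) (supp P) (supp_closed P).

Lemma suppP (P : pred K) c :
  reflect (forall x, ~~ P x -> tcoef x c = 0) (c \in supp P).
Proof. exact: asboolP. Qed.

Lemma tcoef_pure (x y : K) (m : M) : tcoef y (pure x m) = if x == y then m else 0.
Proof. by rewrite /tcoef mcoeffU; case: eqP. Qed.

Lemma pure_supp (P : pred K) x (m : M) : P x -> pure x m \in supp P.
Proof.
move=> Px; apply/suppP => y; rewrite tcoef_pure.
by case: eqP => // <-; rewrite Px.
Qed.

Lemma tens_coefP (c c' : tens M K) : (forall x, tcoef x c = tcoef x c') -> c = c'.
Proof. by move=> cc'; apply/malgP. Qed.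

Lemma supp_ind (N : lmodType R) (f : {linear tens M K -> N})
    (S : submodClosed N) (P : pred K) :
  (forall x m, P x -> f (pure x m) \in S) ->
  forall c, c \in supp P -> f c \in S.
Proof.
move=> fS c /suppP c0; rewrite (tensE c) linear_sum rpred_sum // => x _.
have [Px|/c0->] := boolP (P x); first exact: fS.
by rewrite !linear0 rpred0.
Qed.

Lemma supp_ext (N : lmodType R) (f g : {linear tens M K -> N}) (P : pred K) :
  (forall x m, P x -> f (pure x m) = g (pure x m)) ->
  forall c, c \in supp P -> f c = g c.
Proof.
move=> fg c /suppP c0; rewrite (tensE c) !linear_sum; apply: eq_bigr => x _.
have [Px|/c0->] := boolP (P x); first exact: fg.
by rewrite !linear0.
Qed.

Lemma sub_supp (P Q : pred K) c :
  (forall x, P x -> Q x) -> c \in supp P -> c \in supp Q.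
Proof.
move=> PQ /suppP c0; apply/suppP => x Qx.
by apply: c0; apply: contra Qx; apply: PQ.
Qed.

Lemma suppI (P Q : pred K) c :
  c \in supp P -> c \in supp Q -> c \in supp (fun x => P x && Q x).
Proof.
move=> /suppP cP /suppP cQ; apply/suppP => x.
by rewrite negb_and => /orP[/cP|/cQ].
Qed.

Lemma supp_pred0 c : c \in supp pred0 -> c = 0.
Proof. by move=> /suppP c0; apply: tens_coefP => x; rewrite c0 // linear0. Qed.

Lemma supp_all c : c \in supp predT.
Proof. exact/suppP. Qed.

End Support.

Section ListComplex.
Variables (R : comPzRingType) (r : nat) (X : multispindle r).

(* A list represents a sequence with [x_0] at its head, so that the empty list
   carries the augmentation module. *)
Notation lchain M := (tens M (seq X) : lmodType R).

Section Operators.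
Variable M : lmodType R.

Definition pre (l : seq X) (c : lchain M) : lchain M :=
  tlift (fun s => pure (l ++ s)) c.

Fact pre_is_linear l : linear (pre l).
Proof. exact: linearP. Qed.
HB.instance Definition _ l := GRing.isLinear.Build R (lchain M) (lchain M) _
  (pre l) (pre_is_linear l).

Lemma pre_pure l s m : pre l (pure s m) = pure (l ++ s) m.
Proof. exact: tlift_pure. Qed.

Lemma pre_cat l l' c : pre (l ++ l') c = pre l (pre l' c).
Proof.
pose f : {linear lchain M -> lchain M} := pre l \o pre l'.
apply: (@tens_ext _ _ _ _ (pre (l ++ l')) f) => s m.
by rewrite /f /= !pre_pure catA.
Qed.

Lemma pre_supp (P Q : pred (seq X)) l c :
  (forall s, P s -> Q (l ++ s)) -> c \in supp P -> pre l c \in supp Q.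
Proof.
move=> PQ; apply: (@supp_ind _ _ _ _ (pre l)) => s m Ps; rewrite /= pre_pure.
by apply: pure_supp; apply: PQ.
Qed.

(** The face at the head entry has as sign the parity of the number of entries behind it. As an
    operator, this sign applies to chains of mixed length. *)
Definition sgn (c : lchain M) : lchain M :=
  tlift (fun s => (-1) ^+ size s \*: pure s) c.

Fact sgn_is_linear : linear sgn.
Proof. exact: linearP. Qed.
HB.instance Definition _ := GRing.isLinear.Build R (lchain M) (lchain M) _
  sgn sgn_is_linear.

Lemma sgn_pure s m : sgn (pure s m) = (-1) ^+ size s *: pure s m.
Proof. exact: tlift_pure. Qed.

Lemma sgn_homog n c : c \in supp (fun s => size s == n) -> sgn c = (-1) ^+ n *: c.
Proof.
apply: (@supp_ext _ _ _ _ sgn ((-1) ^+ n \*: idfun)) => s m /eqP <- /=.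
exact: sgn_pure.
Qed.

Lemma sgn_supp (P : pred (seq X)) c : c \in supp P -> sgn c \in supp P.
Proof.
apply: (@supp_ind _ _ _ _ sgn) => s m Ps.
by rewrite /= sgn_pure rpredZ // pure_supp.
Qed.

Lemma sgn_pre l c : sgn (pre l c) = (-1) ^+ size l *: pre l (sgn c).
Proof.
pose f : {linear lchain M -> lchain M} := sgn \o pre l.
pose g : {linear lchain M -> lchain M} := (-1) ^+ size l \*: (pre l \o sgn).
apply: (@tens_ext _ _ _ _ f g) => s m; rewrite /f /g /= pre_pure !sgn_pure.
by rewrite linearZ /= pre_pure size_cat exprD scalerA.
Qed.

Lemma sgnK c : sgn (sgn c) = c.
Proof.
pose f : {linear lchain M -> lchain M} := sgn \o sgn.
apply: (@tens_ext _ _ _ _ f idfun) => s m; rewrite /f /= sgn_pure linearZ /=.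
by rewrite sgn_pure scalerA -exprD addnn -signr_odd odd_double scale1r.
Qed.

Variables (A : action X M) (a : 'I_r -> R).

Definition lact (k : 'I_r) (x : X) (c : lchain M) : lchain M :=
  tlift (fun s => pure [seq ms_op k y x | y <- s] \o A k x) c.

Fact lact_is_linear k x : linear (lact k x).
Proof. exact: linearP. Qed.
HB.instance Definition _ k x := GRing.isLinear.Build R (lchain M) (lchain M) _
  (lact k x) (lact_is_linear k x).

Lemma lact_pure k x s m :
  lact k x (pure s m) = pure [seq ms_op k y x | y <- s] (A k x m).
Proof. exact: tlift_pure. Qed.

Lemma lact_distr i j x y c :
  lact j y (lact i x c) = lact i (ms_op j x y) (lact j y c).
Proof.
pose f : {linear lchain M -> lchain M} := lact j y \o lact i x.
pose g : {linear lchain M -> lchain M} := lact i (ms_op j x y) \o lact j y.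
apply: (@tens_ext _ _ _ _ f g) => s m; rewrite /f /g /= !lact_pure act_distr.
by rewrite -!map_comp; congr pure; apply: eq_map => z /=; rewrite ms_distr.
Qed.

Definition lact_action : action X (lchain M) :=
  @Action _ _ _ (lchain M) (fun k x => lact k x) lact_distr.

Definition cact (x : X) (c : lchain M) : lchain M :=
  compound lact_action a x c.

Fact cact_is_linear x : linear (cact x).
Proof. exact: linearP. Qed.
HB.instance Definition _ x := GRing.isLinear.Build R (lchain M) (lchain M) _
  (cact x) (cact_is_linear x).

Lemma cactE x c : cact x c = \sum_k a k *: lact k x c.
Proof. by []. Qed.

Lemma lact_cact k x y c : lact k y (cact x c) = cact (ms_op k x y) (lact k y c).
Proof.
rewrite !cactE linear_sum; apply: eq_bigr => i _.
by rewrite linearZ /= lact_distr.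
Qed.

Lemma lact_pre k x l c :
  lact k x (pre l c) = pre [seq ms_op k y x | y <- l] (lact k x c).
Proof.
pose f : {linear lchain M -> lchain M} := lact k x \o pre l.
pose g : {linear lchain M -> lchain M} :=
  pre [seq ms_op k y x | y <- l] \o lact k x.
apply: (@tens_ext _ _ _ _ f g) => s m; rewrite /f /g /= pre_pure !lact_pure.
by rewrite pre_pure map_cat.
Qed.

Lemma lact_sgn k x c : lact k x (sgn c) = sgn (lact k x c).
Proof.
pose f : {linear lchain M -> lchain M} := lact k x \o sgn.
pose g : {linear lchain M -> lchain M} := sgn \o lact k x.
apply: (@tens_ext _ _ _ _ f g) => s m.
rewrite /f /g /= sgn_pure (linearZZ (lact k x)).
by rewrite /= !lact_pure sgn_pure size_map.
Qed.

Lemma cact_supp (P : pred (seq X)) c x :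
  (forall k s, P s -> P [seq ms_op k y x | y <- s]) ->
  c \in supp P -> cact x c \in supp P.
Proof.
move=> PP cP; rewrite cactE rpred_sum // => k _; rewrite rpredZ //.
apply: (@supp_ind _ _ _ _ (lact k x)) cP => s m Ps.
by rewrite /= lact_pure pure_supp // PP.
Qed.

(** With x_0 at the head, the faces at the other entries leave x_0 alone, and the face at x_0 acts
    with it on everything else. On one-entry lists this recursion gives the augmentation. *)
Fixpoint bdl (l : seq X) : {linear M -> lchain M} :=
  if l is x :: l' then (pre [:: x] \o bdl l') \+ (cact x \o (sgn \o pure l'))
  else \0.

Definition lbd (c : lchain M) : lchain M := tlift bdl c.

Fact lbd_is_linear : linear lbd.
Proof. exact: linearP. Qed.
HB.instance Definition _ := GRing.isLinear.Build R (lchain M) (lchain M) _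
  lbd lbd_is_linear.

Lemma lbd_nil m : lbd (pure [::] m) = 0.
Proof. exact: tlift_pure. Qed.

Lemma lbd_pre1 x c : lbd (pre [:: x] c) = pre [:: x] (lbd c) + cact x (sgn c).
Proof.
pose f : {linear lchain M -> lchain M} := lbd \o pre [:: x].
pose g : {linear lchain M -> lchain M} := (pre [:: x] \o lbd) \+ (cact x \o sgn).
apply: (@tens_ext _ _ _ _ f g) => s m;  rewrite /f /g /= pre_pure.
by rewrite /lbd !tlift_pure.
Qed.

Lemma lbd_cons x s m :
  lbd (pure (x :: s) m) =
  pre [:: x] (lbd (pure s m)) + (-1) ^+ size s *: cact x (pure s m).
Proof. by rewrite -(pre_pure [:: x]) lbd_pre1 sgn_pure linearZ. Qed.

Lemma lact_lbd k x c : lact k x (lbd c) = lbd (lact k x c).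
Proof.
pose f : {linear lchain M -> lchain M} := lact k x \o lbd.
pose g : {linear lchain M -> lchain M} := lbd \o lact k x.
apply: (@tens_ext _ _ _ _ f g) => s m; rewrite /f /g /=.
elim: s => [|y s IHs]; first by rewrite lact_pure !lbd_nil linear0.
rewrite -(pre_pure [:: y]) lact_pre !lbd_pre1 linearD /= lact_pre IHs.
by rewrite lact_cact lact_sgn.
Qed.

Lemma cact_lbd x c : cact x (lbd c) = lbd (cact x c).
Proof.
rewrite !cactE linear_sum; apply: eq_bigr => k _.
by rewrite linearZ /= lact_lbd.
Qed.

Lemma lbd_homog n c :
  c \in supp (fun s => size s == n.+1) -> lbd c \in supp (fun s => size s == n).
Proof.
apply: (@supp_ind _ _ _ _ lbd) => s m /=.
elim: s n => [//|x s IHs] n; rewrite /= eqSS => sn.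
rewrite lbd_cons rpredD //.
  case: n sn => [/nilP->|n /IHs]; first by rewrite lbd_nil linear0 rpred0.
  by apply: pre_supp.
rewrite rpredZ // cact_supp ?pure_supp // => k s' /=; by rewrite size_map.
Qed.

Lemma sgn_lbd c : sgn (lbd c) = - lbd (sgn c).
Proof.
pose f : {linear lchain M -> lchain M} := sgn \o lbd.
pose g : {linear lchain M -> lchain M} := \- (lbd \o sgn).
apply: (@tens_ext _ _ _ _ f g) => s m; rewrite /f /g /=.
case: s => [|x s].
  by rewrite sgn_pure lbd_nil expr0 scale1r lbd_nil linear0 oppr0.
rewrite sgn_pure linearZ /= exprS mulN1r scaleNr opprK.
by apply/sgn_homog/lbd_homog; rewrite pure_supp /=.
Qed.

(** The cross terms of the recursion cancel: the compound action commutes with [lbd], while [sgn]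
    anticommutes with it. *)
Lemma lbd_lbd c : lbd (lbd c) = 0.
Proof.
pose f : {linear lchain M -> lchain M} := lbd \o lbd.
apply: (@tens_ext _ _ _ _ f \0) => s m; rewrite /f /=.
elim: s => [|x s IHs]; first by rewrite lbd_nil linear0.
rewrite -(pre_pure [:: x]) lbd_pre1 linearD /= lbd_pre1 IHs linear0 add0r.
by rewrite sgn_lbd linearN /= -cact_lbd addNr.
Qed.

Lemma lbd_dup1 x c :
  lbd (pre [:: x; x] c) = pre [:: x; x] (lbd c).
Proof.
rewrite (pre_cat [:: x] [:: x]) !lbd_pre1 linearD /= sgn_pre expr1 scaleN1r.
have -> : cact x (- pre [:: x] (sgn c)) = - pre [:: x] (cact x (sgn c)).
  rewrite linearN /=; congr (- _); rewrite !cactE linear_sum.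
  apply: eq_bigr => k _ /=.
  by rewrite lact_pre linearZ /= ms_idem.
by rewrite addrK -pre_cat.
Qed.

End Operators.
End ListComplex.

(** * Chains on tuples inside the chains on lists *)

Section Embedding.
Variables (R : comPzRingType) (r : nat) (X : multispindle r).
Variable M : lmodType R.
Notation lchain := (tens M (seq X) : lmodType R).

Definition emb n (c : tens M {ffun 'I_n -> X}) : lchain :=
  tlift (fun x : {ffun 'I_n -> X} => pure (codom x)) c.

Fact emb_is_linear n : linear (@emb n).
Proof. exact: linearP. Qed.
HB.instance Definition _ n := GRing.isLinear.Build R
  (tens M {ffun 'I_n -> X}) lchain _ (@emb n) (@emb_is_linear n).

Lemma emb_pure n (x : {ffun 'I_n -> X}) m : emb (pure x m) = pure (codom x) m.
Proof. exact: tlift_pure. Qed.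

Lemma codom_ffun_inj n : injective (fun x : {ffun 'I_n -> X} => codom x).
Proof.
move=> x y /eq_in_map xy; apply/ffunP => i.
by apply: xy; rewrite mem_enum.
Qed.

Lemma size_codom_ord n (x : {ffun 'I_n -> X}) : size (codom x) = n.
Proof. by rewrite size_codom card_ord. Qed.

Lemma codom_ex n (s : seq X) : size s = n ->
  exists x : {ffun 'I_n -> X}, codom x = s.
Proof.
move=> sn; exists [ffun i => tnth (Tuple (introT eqP sn)) i].
rewrite -[RHS](map_tnth_enum (Tuple (introT eqP sn))) /codom /image_mem.
by apply: eq_map => i; rewrite ffunE.
Qed.

Lemma nth_codom_ord n (x : {ffun 'I_n -> X}) x0 (i : 'I_n) :
  nth x0 (codom x) i = x i.
Proof. by rewrite (nth_map i) ?size_enum_ord // nth_ord_enum. Qed.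

Lemma tcoef_emb n (x : {ffun 'I_n -> X}) (c : tens M {ffun 'I_n -> X}) :
  tcoef (codom x) (emb c) = tcoef x c.
Proof.
pose f : {linear tens M {ffun 'I_n -> X} -> M} := tcoef (codom x) \o @emb n.
apply: (@tens_ext _ _ _ _ f (tcoef x)) => y m; rewrite /f /= emb_pure.
by rewrite !tcoef_pure (inj_eq (@codom_ffun_inj n)).
Qed.

Lemma emb_inj n : injective (@emb n).
Proof. by move=> c c' cc'; apply: tens_coefP => x; rewrite -!tcoef_emb cc'. Qed.

Lemma emb_homog n (c : tens M {ffun 'I_n -> X}) :
  emb c \in supp (fun s => size s == n).
Proof.
apply: (@supp_ind _ _ _ _ (@emb n)) (supp_all c) => x m _ /=.
by rewrite emb_pure pure_supp ?size_codom_ord.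
Qed.

Lemma emb_onto n (c : lchain) : c \in supp (fun s => size s == n) ->
  exists b : tens M {ffun 'I_n -> X}, emb b = c.
Proof.
move=> cn; suff /asboolP : c \in im_sub (@emb n) by [].
apply: (@supp_ind _ _ _ _ idfun) cn => s m /eqP/codom_ex[x <-] /=.
by apply/asboolP; exists (pure x m); exact: emb_pure.
Qed.

Variables (A : action X M) (a : 'I_r -> R).

Lemma emb_act n k y c : emb (chain_act A n k y c) = lact A k y (emb c).
Proof.
pose f : {linear chain X M n -> lchain} := @emb n.+1 \o chain_act A n k y.
pose g : {linear chain X M n -> lchain} := lact A k y \o @emb n.+1.
apply: (@tens_ext _ _ _ _ f g) => x m; rewrite /f /g /= chain_act_pure.
rewrite !emb_pure lact_pure /codom /image_mem -map_comp.
by congr pure; apply: eq_map => i /=; rewrite ffunE.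
Qed.

Definition lface k (x0 : X) i (s : seq X) : seq X :=
  take i s ++ [seq ms_op k z (nth x0 s i) | z <- drop i.+1 s].

Lemma lbd_pure x0 s m : lbd A a (pure s m) =
  \sum_k a k *: \sum_(i < size s)
    (-1) ^+ (size s - i.+1) *: pure (lface k x0 i s) (A k (nth x0 s i) m).
Proof.
elim: s => [|y s IHs].
  by rewrite lbd_nil big1 // => k _; rewrite big_ord0 scaler0.
rewrite lbd_cons IHs (linear_sum (pre [:: y])) cactE scaler_sumr -big_split.
apply: eq_bigr => k _ /=.
rewrite (linearZZ (pre [:: y])) big_ord_recl /= subn1 scalerDr addrC.
rewrite scalerA mulrC -scalerA lact_pure /lface /= drop0; congr (_ + _ *: _).
rewrite (linear_sum (pre [:: y])); apply: eq_bigr => i _.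
by rewrite (linearZZ (pre [:: y])) /= pre_pure subSS.
Qed.

Lemma codom_face n k (i : 'I_n.+2) (x : {ffun 'I_n.+2 -> X}) :
  codom (face k i x) = lface k (x ord0) i (codom x).
Proof.
have ssz : size (lface k (x ord0) i (codom x)) = n.+1.
  rewrite size_cat size_map size_take size_drop size_codom_ord ltn_ord.
  by have := ltn_ord i; lia.
apply: (@eq_from_nth _ (x ord0)); rewrite size_codom_ord ?ssz // => j jn.
rewrite -[j]/(val (Ordinal jn)) nth_codom_ord faceE /=.
rewrite nth_cat size_take size_codom_ord ltn_ord; case: ltnP => ji.
  rewrite nth_take // -[in RHS](@inordK n.+1 j) ?nth_codom_ord //; lia.
rewrite (nth_map (x ord0)) ?size_drop ?size_codom_ord; last by lia.
rewrite nth_codom_ord nth_drop; congr (ms_op _ _ _).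
have -> : (i.+1 + (j - i) = j.+1)%N by lia.
by rewrite -[in RHS](@inordK n.+1 j.+1) ?nth_codom_ord.
Qed.

Lemma emb_bd n (c : chain X M n.+1) : emb (bd A a c) = lbd A a (emb c).
Proof.
pose f : {linear chain X M n.+1 -> lchain} := @emb n.+1 \o @bd _ _ _ _ A a n.
pose g : {linear chain X M n.+1 -> lchain} := lbd A a \o @emb n.+2.
apply: (@tens_ext _ _ _ _ f g) => x m; rewrite /f /g /= emb_pure.
rewrite (lbd_pure (x ord0)) /bd (linear_sum (@emb n.+1)); apply: eq_bigr => k _.
rewrite (linearZZ (@emb n.+1)) (linear_sum (@emb n.+1)); congr (_ *: _).
rewrite size_codom_ord; apply: eq_bigr => i _.
rewrite (linearZZ (@emb n.+1)) dface_pure /= emb_pure codom_face.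
by rewrite nth_codom_ord subSS.
Qed.

(** In the shifted indexing of the augmented complex, s is the number of entries, and M sits on the
    empty list. *)
Definition aemb s : {linear aug_obj X M s -> lchain} :=
  if s is s'.+1 then @emb s'.+1 else pure [::].

Lemma aemb_d s c : aemb s (aug_d A a s c) = lbd A a (aemb s.+1 c).
Proof.
case: s c => [|s] c; last exact: emb_bd.
pose f : {linear chain X M 0 -> lchain} := pure [::] \o aug A a.
pose g : {linear chain X M 0 -> lchain} := lbd A a \o @emb 1.
apply: (@tens_ext _ _ _ _ f g) => x m; rewrite /f /g /= emb_pure aug_pure.
have -> : codom x = [:: x ord0] by rewrite /codom /image_mem enum_ordSl enum_ord0.
rewrite lbd_cons lbd_nil linear0 add0r scale1r cactE /compound linear_sum.
by apply: eq_bigr => k _; rewrite linearZ /= lact_pure.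
Qed.

Lemma aemb_act s k y c : aemb s (aug_action A a s k y c) = lact A k y (aemb s c).
Proof.
by case: s c => [|s] c; [rewrite [RHS]lact_pure | exact: emb_act].
Qed.

Lemma aemb_inj s : injective (aemb s).
Proof.
case: s => [|s]; last exact: emb_inj.
by move=> m m' /(congr1 (tcoef [::])); rewrite /= !tcoef_pure.
Qed.

Lemma aemb_homog s c : aemb s c \in supp (fun l => size l == s).
Proof. by case: s c => [|s] c; [apply: pure_supp | apply: emb_homog]. Qed.

Lemma aemb_onto s (c : lchain) : c \in supp (fun l => size l == s) ->
  exists b, aemb s b = c.
Proof.
case: s => [/suppP c0|s]; last exact: emb_onto.
exists (tcoef [::] c); apply: tens_coefP => -[|y l] /=; rewrite tcoef_pure //=.
by rewrite c0.
Qed.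

End Embedding.

(** * The filtration by the position of the first repetition *)

Section Repetitions.
Variables (r : nat) (X : multispindle r).

Fixpoint rp (j : nat) (s : seq X) : bool :=
  match j, s with
  | j'.+1, x :: s' => (ohead s' == Some x) || rp j' s'
  | _, _ => false
  end.

Lemma rp_le j k s : (j <= k)%N -> rp j s -> rp k s.
Proof.
elim: s j k => [|x s IHs] [|j] [|k] //= jk.
by case: eqP => //= _; apply: IHs.
Qed.

Lemma rp_size j s : rp j s -> rp (size s).-1 s.
Proof.
elim: s j => [|x s IHs] [|j] //=; case: s IHs => [|y s] IHs /=; first by case: j.
by case: eqP => //= _; apply: IHs.
Qed.

Lemma rp_map j (f : X -> X) s : rp j s -> rp j (map f s).
Proof.
elim: s j => [|x s IHs] [|j] //= /orP[|/IHs->]; last by rewrite orbT.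
by case: s {IHs} => //= y s /eqP[->]; rewrite eqxx.
Qed.

Lemma rp_cat j s t : rp j s -> rp j (s ++ t).
Proof.
elim: s j => [|x s IHs] [|j] //= /orP[|/IHs->]; last by rewrite orbT.
by case: s {IHs} => //= y s /eqP[->]; rewrite eqxx.
Qed.

Lemma rp_catr j l s : rp j s -> rp (size l + j) (l ++ s).
Proof. by move=> js; elim: l => //= x l ->; rewrite orbT. Qed.

Lemma rpP j x0 s : reflect
  (exists i, [/\ (i < j)%N, (i.+1 < size s)%N & nth x0 s i = nth x0 s i.+1])
  (rp j s).
Proof.
apply: (iffP idP).
  elim: s j => [|x s IHs] [|j] //= /orP[|/IHs[i [ij is_ e]]]; last by exists i.+1.
  by case: s {IHs} => //= y s /eqP[->]; exists 0%N.
elim: s j => [|x s IHs] [|j] //= [[|i] [//= ij is_ e]].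
  by case: s {IHs} is_ e => //= y s _ ->; rewrite eqxx.
by rewrite IHs ?orbT //; exists i.
Qed.

Lemma degenerateP n (x : {ffun 'I_n.+1 -> X}) :
  reflect (degenerate x) (rp n.+1 (codom x)).
Proof.
have x0 := x ord0; apply: (iffP (rpP _ x0 _)) => [[i [_]]|[i xi]].
  rewrite size_codom_ord ltnS => iN; exists (Ordinal iN).
  by rewrite -!(nth_codom_ord _ x0).
exists i; rewrite size_codom_ord !ltnS ltn_ord ltnW //; split=> //.
by move: xi; rewrite -!(nth_codom_ord _ x0).
Qed.

(** Step p allows a repetition at p itself, whereas the bound of [rp] is strict; hence [k.+1]. *)
Definition rpz (p : int) (s : seq X) : bool :=
  if p is Posz k then rp k.+1 s else false.

Lemma rpz_le p q s : p <= q -> rpz p s -> rpz q s.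
Proof.
by case: p q => [p|p] [q|q] // pq; apply: (@rp_le p.+1 q.+1).
Qed.

End Repetitions.

Section Filtration.
Variables (R : comPzRingType) (r : nat) (X : multispindle r).
Variables (M : lmodType R) (A : action X M) (a : 'I_r -> R).
Notation lchain := (tens M (seq X) : lmodType R).

(** A repetition at the head survives by [lbd_dup1]. For a later one, the head face deletes x and
    moves the repetition one place closer to the head, and the action preserves equal neighbours. *)
Lemma lbd_rp j c : c \in supp (@rp _ X j) ->
  lbd A a c \in (supp (rp j) : {pred lchain}).
Proof.
apply: (@supp_ind _ _ _ _ (lbd A a)) => s m /=.
elim: s j => [|x s IHs] [|j] //= /orP[/eqP|js].
  case: s {IHs} => // _ s [->].
  rewrite -(pre_pure [:: x; x]) lbd_dup1.
  by apply: pre_supp (supp_all _) => t _ /=; rewrite eqxx.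
rewrite lbd_cons rpredD //.
  by apply: pre_supp (IHs _ js) => t jt /=; rewrite jt orbT.
rewrite rpredZ // cact_supp //; first by move=> k t; apply: (@rp_map _ _ j.+1).
exact/pure_supp/(rp_le (leqnSn j)).
Qed.

Definition Fil (p n : int) : submodClosed lchain :=
  supp (fun s => ((size s)%:Z == n + 1) && rpz p s).

Lemma Fil_le (p p' n : int) x : p <= p' -> x \in Fil p n -> x \in Fil p' n.
Proof.
move=> pp'; apply: sub_supp => s /andP[-> /=].
exact: rpz_le.
Qed.

Lemma Fil_lbd (p n : int) x : x \in Fil p n -> lbd A a x \in Fil p (n - 1).
Proof.
move=> xF; apply: suppI.
  apply: (@supp_ind _ _ _ _ (lbd A a)) xF => -[|y s] m /andP[/eqP sn _] /=.
    by rewrite lbd_nil rpred0.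
  apply: (@sub_supp _ _ _ (fun t => size t == size s)).
    by move=> t /eqP->; rewrite subrK; move: sn => /=; clear; lia.
  by apply: lbd_homog; rewrite pure_supp /=.
case: p xF => [p|p] xF.
  by apply: (@lbd_rp p.+1); apply: sub_supp xF => s /andP[].
suff -> : x = 0 by rewrite linear0 rpred0.
by apply: supp_pred0; apply: sub_supp xF => s /andP[].
Qed.

Lemma Fil_neg (p n : int) x : p < 0 -> x \in Fil p n -> x = 0.
Proof.
case: p => // p _ xF.
by apply: supp_pred0; apply: sub_supp xF => s /andP[].
Qed.

Lemma Fil_top (p n : int) x : x \in Fil p n -> x \in Fil (n - 1) n.
Proof.
apply: sub_supp => s /andP[sn]; rewrite sn /=.
case: p => // p /(@rp_size _ _ p.+1); move: sn.
case: s => [|y [|z s]] //= /eqP sn.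
by have -> : n - 1 = size s by move: sn; clear; lia.
Qed.

Lemma Fil_natP (n : nat) (c : lchain) :
  c \in Fil n n <-> c \in supp (fun s => (size s == n.+1) && rp n.+1 s).
Proof.
by split; apply: sub_supp => s /=; rewrite -PoszD addn1.
Qed.

Lemma mem_degenerate n (c : chain X M n) :
  (forall x : {ffun 'I_n.+1 -> X}, ~~ rp n.+1 (codom x) -> tcoef x c = 0) ->
  c \in degenerate_sub X M n.
Proof.
move=> c0; rewrite (tensE c) rpred_sum // => x _.
have [/degenerateP xd|/c0->] := boolP (rp n.+1 (codom x)); last first.
  by rewrite linear0 rpred0.
by apply: mem_lspan; exists x, (tcoef x c).
Qed.

Lemma degenerate_emb n (c : chain X M n) :
  c \in degenerate_sub X M n <-> emb c \in Fil n n.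
Proof.
rewrite Fil_natP; split=> [|/suppP c0].
  apply: (@lspan_sub _ _ _ (@emb _ _ X M n.+1)) => _ [x [m [/degenerateP xd ->]]].
  by rewrite /= emb_pure pure_supp // size_codom_ord eqxx.
apply: mem_degenerate => x xd; rewrite -tcoef_emb c0 //.
by rewrite negb_and xd orbT.
Qed.

Definition hrep n (u : HD A a n) (x : lchain) : Prop :=
  exists y : degenerate_complex A a n, represents u y /\ emb (val y) = x.

Lemma degenerate_ker n (y : degenerate_complex A a n) :
  cx_out (degenerate_complex A a) n y = 0 <-> lbd A a (emb (val y)) = 0.
Proof.
case: n y => [|n] y /=.
  split=> // _; have /degenerate_emb := submod_valP y.
  move=> /Fil_top/Fil_neg -> //.
  by rewrite linear0.
rewrite -emb_bd; split=> [/(congr1 val)/= ->|y0]; first by rewrite linear0.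
by apply/val_inj/emb_inj; rewrite /= y0 linear0.
Qed.

Lemma Fil_page_quadrant (k : nat) (p q : int) : (0 < k)%N -> p < 0 \/ q <= 0 ->
  forall u : fpage (lbd A a) Fil k p q, u = 0.
Proof.
exact: (fpage_quadrant (@Fil_le) (@Fil_neg) (fun p n x _ => @Fil_top p n x)).
Qed.

Definition degenerate_ss : spectral_sequence R :=
  filtered_ss (D := lbd A a) (@lbd_lbd _ _ _ _ A a) (@Fil_le) (@Fil_neg)
    (fun p n x _ => @Fil_top p n x).

Lemma HD_converges : converges degenerate_ss (HD A a).
Proof.
apply: (@filtered_ss_converges _ _ _ _ _ _ _ _ _ hrep).
- move=> n c u _ v _ [y [uy <-]] [z [vz <-]]; exists (c *: y + z).
  by split; [exact: represents_lin | rewrite /= linearP].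
- move=> n u; have [y uy] := ex_represents u.
  exists (emb (val y)); first by exists y.
  split; first exact/degenerate_emb/submod_valP.
  by apply/degenerate_ker/(represents_ker uy).
- move=> n x xF Dx.
  have [|b bx] := @emb_onto _ _ _ _ n.+1 x.
    by move/Fil_natP: xF; apply: sub_supp => s /andP[].
  have bd_ : b \in degenerate_sub X M n by apply/degenerate_emb; rewrite bx.
  have [u uy] : exists u : HD A a n, represents u (Submod bd_).
    by apply/represents_ex/eqP/degenerate_ker; rewrite bx.
  by exists u, (Submod bd_).
- move=> n u _ [y [uy <-]]; rewrite (represents_im uy); split.
    move=> [z <-]; exists (emb (val z)); first exact/degenerate_emb/submod_valP.
    by rewrite /= emb_bd.
  move=> [x xF xy]; have [|b bx] := @emb_onto _ _ _ _ n.+2 x.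
    by move/Fil_natP: xF; apply: sub_supp => s /andP[].
  have bd_ : b \in degenerate_sub X M n.+1 by apply/degenerate_emb; rewrite bx.
  exists (Submod bd_); apply/val_inj/emb_inj.
  by rewrite /= emb_bd bx.
Qed.

End Filtration.

(** * Blocks with a doubled last entry *)

Section Duplication.
Variables (r : nat) (X : multispindle r).

Fixpoint dup (s : seq X) : seq X :=
  if s is x :: s' then x :: (if s' is [::] then [:: x] else dup s') else [::].

Lemma dup_rcons l y : dup (rcons l y) = l ++ [:: y; y].
Proof. by elim: l => //= x l ->; case: l. Qed.

Lemma dup_map f l : map f (dup l) = dup (map f l).
Proof. by case/lastP: l => // l y; rewrite map_rcons !dup_rcons map_cat. Qed.

Lemma size_dup l : (0 < size l)%N -> size (dup l) = (size l).+1.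
Proof.
by case/lastP: l => // l y _; rewrite dup_rcons size_rcons size_cat addn2.
Qed.

Lemma dup_inj : injective dup.
Proof.
case/lastP=> [|l y]; case/lastP=> [|l' y']; rewrite ?dup_rcons //;
  try by case: l'.
  by case: l.
rewrite -!cat_rcons !cats0 => /eqP; rewrite eqseq_rcons => /andP[/eqP //].
Qed.

Lemma rp_dup l t : (0 < size l)%N -> rp (size l) (dup l ++ t).
Proof.
case/lastP: l => // l y _; rewrite dup_rcons size_rcons -catA -addn1.
by apply: rp_catr; rewrite /= eqxx.
Qed.

Lemma rp_dup_pred l t : rp (size l).-1 (dup l ++ t) = rp (size l).-1 l.
Proof.
elim: l => // x [|y l] //= IHl; rewrite -IHl /=.
by case: l {IHl}.
Qed.

(** This splits the p-th graded piece of the filtration into summands, one for each nondegenerate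
    block l of p + 1 entries, with arbitrary tails t'. *)
Lemma rp_split p t : rp p.+1 t -> ~~ rp p t ->
  exists l t', [/\ t = dup l ++ t', size l = p.+1 & ~~ rp p l].
Proof.
elim: p t => [|p IHp] [|x t] //.
  case: t => //= y t; rewrite orbF => /eqP[->] _.
  by exists [:: x], t.
rewrite [rp p.+2 _]/= [rp p.+1 (_ :: _)]/=; case: eqP => //= xt tp tp'.
have [l [t' [tE ls lp]]] := IHp _ tp tp'; exists (x :: l), t'.
case: l ls lp tE => // y l ls lp tE; split; rewrite ?tE //=; first by rewrite -ls.
by rewrite negb_or lp andbT; apply/eqP => yx; apply: xt; rewrite tE.
Qed.

End Duplication.

(** * Reading off the summand of a block *)

Section Prefixes.
Variables (R : comPzRingType) (r : nat) (X : multispindle r).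
Variables (M : lmodType R) (A : action X M) (a : 'I_r -> R).
Notation lchain := (tens M (seq X) : lmodType R).

Definition unpre (l : seq X) (c : lchain) : lchain :=
  tlift (fun s => if prefix l s as _ return {linear M -> lchain}
    then pure (drop (size l) s) else \0) c.

Fact unpre_is_linear l : linear (unpre l).
Proof. exact: linearP. Qed.
HB.instance Definition _ l := GRing.isLinear.Build R lchain lchain _
  (unpre l) (unpre_is_linear l).

Lemma unpre_pure l s m :
  unpre l (pure s m) = if prefix l s then pure (drop (size l) s) m else 0.
Proof. by rewrite /unpre tlift_pure; case: ifP. Qed.

Lemma tcoef_unpre l s c : tcoef s (unpre l c) = tcoef (l ++ s) c.
Proof.
pose f : {linear lchain -> M} := tcoef s \o unpre l.
apply: (@tens_ext _ _ _ _ f (tcoef (l ++ s))) => t m; rewrite /f /= unpre_pure.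
rewrite tcoef_pure; case: prefixP => [[t' ->]|lt].
  by rewrite drop_size_cat // tcoef_pure eqseq_cat // eqxx.
rewrite linear0; case: eqP => // tE; case: lt; by exists s.
Qed.

Lemma unpre_pre l l' c : size l = size l' ->
  unpre l (pre l' c) = if l == l' then c else 0.
Proof.
move=> ll'; apply: tens_coefP => s; rewrite tcoef_unpre.
pose f : {linear lchain -> M} := tcoef (l ++ s) \o pre l'.
pose g : {linear lchain -> M} :=
  if l == l' as _ return {linear lchain -> M} then tcoef s else \0.
rewrite [RHS](_ : _ = g c); last by rewrite /g; case: eqP; rewrite ?linear0.
apply: (@tens_ext _ _ _ _ f g) => t m; rewrite /f /g /= pre_pure tcoef_pure.
rewrite eqseq_cat // [l' == l]eq_sym; case: eqP => //= _.
by rewrite tcoef_pure.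
Qed.

Lemma unpre_dup_rp p l c : size l = p.+1 -> ~~ rp p l ->
  c \in supp (@rp _ X p) -> unpre (dup l) c = 0.
Proof.
move=> lp nl /suppP c0; apply: tens_coefP => s.
rewrite tcoef_unpre linear0 c0 //.
by have := rp_dup_pred l s; rewrite lp /= => ->.
Qed.

(* The faces at the two equal entries cancel, those further to the left only
   see the tail, and those to the right create a repetition closer to [x_0]. *)
Lemma lbd_dup l c : (0 < size l)%N ->
  lbd A a (pre (dup l) c) - pre (dup l) (lbd A a c) \in supp (rp (size l).-1).
Proof.
case/lastP: l => // l y _; rewrite dup_rcons size_rcons /=.
elim: l => [|x l IHl]; first by rewrite lbd_dup1 subrr rpred0.
rewrite -[(x :: l) ++ _]/([:: x] ++ (l ++ [:: y; y])) 2!(pre_cat [:: x] (l ++ _)).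
rewrite lbd_pre1 addrAC -(linearB (pre [:: x])) rpredD //=.
  by apply: pre_supp IHl => t tl /=; rewrite tl orbT.
apply: cact_supp => [k t|]; first exact: (@rp_map _ _ (size l).+1).
apply: sgn_supp; apply: pre_supp (supp_all _) => t _.
suff : rp (size l + 1) ((l ++ [:: y; y]) ++ t) by rewrite addn1.
by rewrite -catA rp_catr //= eqxx.
Qed.

(** The error term of [lbd_dup] lies in a lower step, which [unpre (dup l)] kills for nondegenerate
    l. So d^0 on the summand of l is the boundary of the tail. *)
Lemma unpre_lbd p l c : size l = p.+1 -> ~~ rp p l -> c \in supp (@rp _ X p.+1) ->
  unpre (dup l) (lbd A a c) = lbd A a (unpre (dup l) c).
Proof.
move=> lp nl; pose f : {linear lchain -> lchain} := unpre (dup l) \o lbd A a.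
pose g : {linear lchain -> lchain} := lbd A a \o unpre (dup l).
apply: (@supp_ext _ _ _ _ f g) => t m tp; rewrite /f /g /=.
have [tp'|tp'] := boolP (rp p t).
  rewrite !(unpre_dup_rp lp nl) ?linear0 // ?pure_supp //.
  by apply: lbd_rp; apply: pure_supp.
have [l' [t' [-> l'p nl']]] := rp_split tp tp'.
have ll' : size (dup l) = size (dup l') by rewrite !size_dup ?lp ?l'p.
rewrite -pre_pure unpre_pre //.
have : (0 < size l')%N by rewrite l'p.
move=> /(lbd_dup (pure t' m)); rewrite l'p => /(unpre_dup_rp lp nl).
rewrite linearB /= unpre_pre // => /subr0_eq ->.
by case: eqP => // _; rewrite linear0.
Qed.

End Prefixes.

(** * The first page *)

Section FirstPage.
Variables (R : comPzRingType) (r : nat) (X : multispindle r).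
Variables (M : lmodType R) (A : action X M) (a : 'I_r -> R) (s : nat).
Notation lchain := (tens M (seq X) : lmodType R).
Notation C := (aug_complex A a).
Notation D := (lbd A a).
Notation F := (@Fil R r X M).

Definition cycles : lmodType R := submod (ker_sub (cx_out C s)).

Definition cycles_act k y : {linear cycles -> cycles} :=
  Defs.sub_map (@act_ker _ _ _ C _ (@aug_d_act _ _ _ _ A a) s k y).

Fact cycles_distr i j x y z :
  cycles_act j y (cycles_act i x z) =
  cycles_act i (ms_op j x y) (cycles_act j y z).
Proof. by apply: val_inj; apply: act_distr. Qed.

Definition cycles_action : action X cycles := Action cycles_distr.

Lemma cyclesP (c : aug_obj X M s) :
  c \in ker_sub (cx_out C s) <-> D (aemb X M s c) = 0.
Proof.
rewrite /ker_sub unfold_in; case: s c => [|n] c; first by rewrite eqxx lbd_nil.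
rewrite -aemb_d; split=> [/eqP/= ->|c0]; first by rewrite linear0.
by apply/eqP/(@aemb_inj _ _ _ _ n); rewrite linear0.
Qed.

Lemma lbd_cycles (z : cycles) : D (aemb X M s (val z)) = 0.
Proof. exact/cyclesP/submod_valP. Qed.

(** The cycle serves as the tail behind the doubled block. The empty list has no entry to double and
    is sent to 0, whence the nonemptiness conditions below. *)
Definition beta_list (c : tens cycles (seq X)) : lchain :=
  tlift (fun l => if l is [::] as _ return {linear cycles -> lchain} then \0
                  else pre (dup l) \o (aemb X M s \o val)) c.

Fact beta_list_is_linear : linear beta_list.
Proof. exact: linearP. Qed.
HB.instance Definition _ := GRing.isLinear.Build R (tens cycles (seq X)) lchain _
  beta_list beta_list_is_linear.

Lemma beta_list_nil z : beta_list (pure [::] z) = 0.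
Proof. exact: tlift_pure. Qed.

Lemma beta_list_pure l z : (0 < size l)%N ->
  beta_list (pure l z) = pre (dup l) (aemb X M s (val z)).
Proof. by case: l => // x l _; apply: tlift_pure. Qed.

Lemma beta_list_homog l z : (0 < size l)%N ->
  beta_list (pure l z) \in supp (fun t => size t == (size l + s.+1)%N).
Proof.
move=> l0; rewrite beta_list_pure //.
apply: pre_supp (aemb_homog _) => t /= /eqP ts.
by rewrite size_cat size_dup // ts addnS.
Qed.

Lemma beta_list_pre1 x c : c \in supp (fun l => 0 < size l)%N ->
  beta_list (pre [:: x] c) = pre [:: x] (beta_list c).
Proof.
pose f : {linear tens cycles (seq X) -> lchain} := beta_list \o pre [:: x].
pose g : {linear tens cycles (seq X) -> lchain} := pre [:: x] \o beta_list.
apply: (@supp_ext _ _ _ _ f g) => -[//|y l] z _; rewrite /f /g /= pre_pure.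
by rewrite !beta_list_pure // -pre_cat.
Qed.

Lemma beta_list_lact k x c :
  beta_list (lact cycles_action k x c) = lact A k x (beta_list c).
Proof.
pose f : {linear tens cycles (seq X) -> lchain} :=
  beta_list \o lact cycles_action k x.
pose g : {linear tens cycles (seq X) -> lchain} := lact A k x \o beta_list.
apply: (@tens_ext _ _ _ _ f g) => -[|y l] z; rewrite /f /g /= lact_pure.
  by rewrite !beta_list_nil linear0.
by rewrite !beta_list_pure // lact_pre dup_map -aemb_act.
Qed.

Lemma beta_list_cact x c :
  beta_list (cact cycles_action a x c) = cact A a x (beta_list c).
Proof.
rewrite !cactE linear_sum; apply: eq_bigr => k _.
by rewrite (linearZZ beta_list) /= beta_list_lact.
Qed.

(* Compares the two boundaries up to the face of the normalized complex at the
   last entry [y], which acts trivially on the homology. *)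
Lemma lbd_beta_list l y z :
  let w t := lbd cycles_action a (pure (rcons t y) z) -
             pure t (compound cycles_action a y z) in
  w l \in supp (fun t => 0 < size t)%N /\
  D (beta_list (pure (rcons l y) z)) = (-1) ^+ s.+1 *: beta_list (w l).
Proof.
move=> w; have w0 : w [::] = 0.
  rewrite /w lbd_cons lbd_nil linear0 add0r scale1r cactE.
  rewrite /compound (linear_sum (pure [::])) -sumrB big1 // => k _.
  by rewrite lact_pure (linearZZ (pure [::])) subrr.
have wE x t : w (x :: t) = pre [:: x] (w t) +
    (-1) ^+ (size t).+1 *: cact cycles_action a x (pure (rcons t y) z).
  rewrite /w -(pre_pure [:: x] t) lbd_cons size_rcons addrAC.
  by rewrite -(linearB (pre [:: x])).
move: w w0 wE => w w0 wE; elim: l => [|x l [wl0 Dwl]].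
  rewrite w0 linear0 scaler0 rpred0; split=> //.
  by rewrite beta_list_pure //= lbd_dup1 lbd_cycles linear0.
split; rewrite wE.
  rewrite rpredD //; first by apply: pre_supp wl0.
  rewrite rpredZ // cact_supp ?pure_supp ?size_rcons // => k t.
  by rewrite size_map.
rewrite rcons_cons -(pre_pure [:: x]) beta_list_pre1; last first.
  by rewrite pure_supp ?size_rcons.
have b0 : (0 < size (rcons l y))%N by rewrite size_rcons.
(* Compared with [rcons l y], the chain has [s.+1] more entries behind x: the second copy of y and
   the s entries of the tail. This is the origin of the sign. *)
rewrite lbd_pre1 Dwl (sgn_homog (beta_list_homog z b0)) (linearD beta_list) /=.
rewrite beta_list_pre1 // (linearZZ (pre [:: x])) (linearZZ beta_list) /=.
rewrite beta_list_cact scalerDr scalerA.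
rewrite (linearZZ (cact A a x)) size_rcons; congr (_ + _ *: _).
by rewrite addnC exprD.
Qed.

Lemma rpz_pred p (t : seq X) : rpz (p%:Z - 1) t = rp p t.
Proof. by case: p => [|p] //; have -> : p.+1%:Z - 1 = p by clear; lia. Qed.

(** The total degree of a doubled block of p + 2 entries followed by s more; thus q = s + 1. *)
Notation N p := (p%:Z + s.+1%:Z).

(** The conditions on boundaries in Z^0 are automatic because [D] preserves the filtration. *)
Lemma fb1P p n x : reflect
  (exists y z, [/\ y \in F p (n + 1), z \in F (p - 1) n & x = D y + z])
  (x \in fb D F 1%:Z p n).
Proof.
apply: (iffP (fbP _ _ _ _ _ _)) => -[y [z [yF zF xE]]]; exists y, z.
  move/fzP: yF => [yF _]; move/fzP: zF => [zF _]; split=> //.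
  by apply: Fil_cast yF; clear; lia.
split=> //; apply/fzP; split=> //.
- by apply: Fil_cast yF; clear; lia.
- by apply: Fil_cast (Fil_lbd A a yF); clear; lia.
- by apply: Fil_cast (Fil_lbd A a zF); clear; lia.
Qed.

Lemma Fil_fb1 p n x : x \in F (p - 1) n -> x \in fb D F 1%:Z p n.
Proof.
by move=> xF; apply/fb1P; exists 0, x; rewrite rpred0 linear0 add0r.
Qed.

(** By [lbd_dup], moving the boundary outside the block costs only a term in step p - 1, so a
    bounding tail gives zero in E^1. *)
Lemma pre_dup_lbd_fb1 (p : nat) l w : size l = p.+1 ->
  w \in supp (fun t : seq X => size t == s.+1) ->
  pre (dup l) (D w) \in fb D F 1%:Z p (N p).
Proof.
move=> lp ws; have l0 : (0 < size l)%N by rewrite lp.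
have dF : pre (dup l) w \in F p (N p + 1).
  apply: pre_supp ws => t /eqP ts; rewrite /= size_cat size_dup // lp ts.
  have := rp_dup t l0; rewrite lp /= => ->; rewrite andbT.
  by apply/eqP; clear; lia.
apply/fb1P; exists (pre (dup l) w), (pre (dup l) (D w) - D (pre (dup l) w)).
split=> //; last by rewrite addrC subrK.
apply: (@sub_supp _ _ _ (fun t => ((size t)%:Z == N p + 1) && rp p t)).
  by move=> t; rewrite rpz_pred.
apply: suppI; last first.
  rewrite -opprB; apply: submod_rpredN.
  by have := lbd_dup A a w l0; rewrite lp.
apply: submod_rpredB.
  apply: pre_supp (lbd_homog _ _ ws) => t /= /eqP ts.
  by rewrite size_cat size_dup // lp ts; apply/eqP; clear; lia.
have := Fil_lbd A a dF; apply: sub_supp => t /andP[+ _].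
by rewrite addrK.
Qed.

Definition beta p (u : chain X cycles p) : lchain := beta_list (emb u).

Fact beta_is_linear p : linear (@beta p).
Proof. by move=> c u v; rewrite /beta !linearP. Qed.
HB.instance Definition _ p := GRing.isLinear.Build R (chain X cycles p) lchain _
  (@beta p) (@beta_is_linear p).

Lemma beta_pure p (x : {ffun 'I_p.+1 -> X}) z :
  beta (pure x z) = pre (dup (codom x)) (aemb X M s (val z)).
Proof. by rewrite /beta emb_pure beta_list_pure // size_codom_ord. Qed.

Lemma beta_Fil p (u : chain X cycles p) : beta u \in F p (N p).
Proof.
apply: (@supp_ind _ _ _ _ (@beta p)) (supp_all u) => x z _ /=.
rewrite beta_pure; apply: pre_supp (aemb_homog _) => t /= /eqP ts.
have xs := size_codom_ord x.
rewrite size_cat size_dup ?xs // ts.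
have := @rp_dup _ X (codom x) t; rewrite xs /= => -> //; rewrite andbT.
by apply/eqP; clear; lia.
Qed.

Lemma beta_fz p (u : chain X cycles p) : beta u \in fz D F 1%:Z p (N p).
Proof.
apply/fzP; split; first exact: beta_Fil.
apply: (@sub_supp _ _ _ (fun t => ((size t)%:Z == N p - 1 + 1) && rp p t)).
  by move=> t; rewrite rpz_pred.
apply: suppI.
  by have := Fil_lbd A a (beta_Fil u); apply: sub_supp => t /andP[].
pose f : {linear chain X cycles p -> lchain} := D \o @beta p.
apply: (@supp_ind _ _ _ _ f) (supp_all u) => x z _ /=; rewrite beta_pure.
have xs := size_codom_ord x.
have := @lbd_dup _ _ _ _ A a (codom x) (aemb X M s (val z)).
by rewrite xs lbd_cycles linear0 subr0; apply.
Qed.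

Lemma unpre_beta p (u : chain X cycles p) (x : {ffun 'I_p.+1 -> X}) :
  unpre (dup (codom x)) (beta u) = aemb X M s (val (tcoef x u)).
Proof.
pose f : {linear chain X cycles p -> lchain} := unpre (dup (codom x)) \o @beta p.
pose g : {linear chain X cycles p -> lchain} := aemb X M s \o (val \o tcoef x).
apply: (@tens_ext _ _ _ _ f g) => y z; rewrite /f /g /= beta_pure.
rewrite unpre_pre ?size_dup ?size_codom_ord // tcoef_pure.
rewrite (inj_eq (@dup_inj _ X)) (inj_eq (@codom_ffun_inj _ X _)) eq_sym.
by case: eqP => // _; rewrite !linear0.
Qed.

Lemma unpre_homog p c (x : {ffun 'I_p.+1 -> X}) n q : c \in F q n ->
  unpre (dup (codom x)) c \in supp (fun t => (size t)%:Z == n - p.+1%:Z).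
Proof.
move=> /suppP c0; apply/suppP => t tn; rewrite tcoef_unpre c0 //.
rewrite negb_and size_cat size_dup size_codom_ord //.
suff -> : ((p.+2 + size t)%N%:Z == n + 1) = ((size t)%:Z == n - p.+1%:Z).
  by rewrite tn.
by clear; apply/eqP/eqP; lia.
Qed.

Lemma unpre_homog_nat p c (x : {ffun 'I_p.+1 -> X}) n k q :
  n = p.+1%:Z + k%:Z -> c \in F q n ->
  unpre (dup (codom x)) c \in supp (fun t => size t == k).
Proof.
move=> -> /(unpre_homog x); apply: sub_supp => t.
by rewrite [_ + k%:Z]addrC addrK.
Qed.

Lemma unpre_Fil_pred p c (x : {ffun 'I_p.+1 -> X}) n :
  ~~ rp p (codom x) -> c \in F (p%:Z - 1) n -> unpre (dup (codom x)) c = 0.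
Proof.
move=> xd cF; apply: (unpre_dup_rp (size_codom_ord x) xd).
by apply: sub_supp cF => t /andP[_]; rewrite rpz_pred.
Qed.

Lemma unpre_lbd_Fil (p : nat) c (x : {ffun 'I_p.+1 -> X}) n :
  ~~ rp p (codom x) -> c \in F p n ->
  unpre (dup (codom x)) (D c) = D (unpre (dup (codom x)) c).
Proof.
move=> xd cF; apply: unpre_lbd (size_codom_ord x) xd _.
by apply: sub_supp cF => t /andP[].
Qed.

(** Forwards, [unpre] recovers each coefficient and turns the bounding chain into a bounding tail.
    Backwards, a degenerate x already repeats before p, so its block lies in step p - 1; this is why
    only nondegenerate sequences count. *)
Lemma beta_fb p (u : chain X cycles p) :
  beta u \in fb D F 1%:Z p (N p) <->
  forall x : {ffun 'I_p.+1 -> X}, ~~ rp p (codom x) ->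
    val (tcoef x u) \in im_sub (cx_d C s).
Proof.
split=> [/fb1P[y [z [yF zF uE]]] x xd|imu].
  have [|b bE] := @aemb_onto _ _ _ M s.+1 (unpre (dup (codom x)) y).
    by apply: unpre_homog_nat yF; clear; lia.
  apply/asboolP; exists b; apply: (@aemb_inj _ _ X M s); rewrite -unpre_beta uE.
  rewrite linearD /= (unpre_Fil_pred xd zF) addr0 (unpre_lbd_Fil xd yF) -bE.
  exact: aemb_d.
rewrite (tensE u) linear_sum rpred_sum // => x _ /=; rewrite beta_pure.
have [xd|/imu/asboolP[w <-]] := boolP (rp p (codom x)); last first.
  rewrite (aemb_d A a w); apply: pre_dup_lbd_fb1 (size_codom_ord x) _.
  exact: aemb_homog.
apply: Fil_fb1; apply: pre_supp (aemb_homog _) => t /= /eqP ts.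
rewrite rpz_pred (rp_cat t) //=; last first.
  by have := rp_dup_pred (codom x) [::]; rewrite cats0 size_codom_ord /= => ->.
rewrite andbT size_cat size_dup ?size_codom_ord // ts.
by apply/eqP; clear; lia.
Qed.

(** The coefficient at a nondegenerate x is the tail of c behind the block of x. It is a cycle
    because D c lies in step p - 1, which [unpre] kills. *)
Lemma beta_onto (p : nat) c : c \in fz D F 1%:Z p (N p) ->
  exists u : chain X cycles p, c - beta u \in F (p%:Z - 1) (N p).
Proof.
move=> /fzP[cF DcF].
have /choice[f fP] : forall x : {ffun 'I_p.+1 -> X}, exists z : cycles,
    ~~ rp p (codom x) -> aemb X M s (val z) = unpre (dup (codom x)) c.
  move=> x; have [xd|xd] := boolP (rp p (codom x)); first by exists 0.
  have [|b bE] := @aemb_onto _ _ _ M s (unpre (dup (codom x)) c).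
    by apply: unpre_homog_nat cF; clear; lia.
  have bZ : b \in ker_sub (cx_out C s).
    by apply/cyclesP; rewrite bE -(unpre_lbd_Fil xd cF) (unpre_Fil_pred xd DcF).
  by exists (Submod bZ).
(* A list begins with at most one doubled block of given length, so the finite support of c meets
   finitely many blocks and u is a finite sum. *)
have /choice[g gP] : forall t : seq X, exists xs : seq {ffun 'I_p.+1 -> X},
    forall (x : {ffun 'I_p.+1 -> X}) t', t = dup (codom x) ++ t' -> x \in xs.
  move=> t; have [[x [t' tE]]|nt] := pselect (exists (x : {ffun 'I_p.+1 -> X}) t',
      t = dup (codom x) ++ t'); last first.
    by exists [::] => x t' tE; case: nt; exists x, t'.
  exists [:: x] => y t''; rewrite tE => /eqP.
  rewrite eqseq_cat ?size_dup ?size_codom_ord // => /andP[/eqP/dup_inj xy _].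
  by rewrite inE (codom_ffun_inj xy).
pose xs := undup (flatten [seq g t | t <- msupp (c : {malg M[seq X]})]).
pose u : chain X cycles p := \sum_(x <- xs) pure x (f x).
have uE x : tcoef x u = if x \in xs then f x else 0.
  rewrite linear_sum /=; under eq_bigr do rewrite tcoef_pure.
  case: ifP => [xin|xn].
    by rewrite (bigD1_seq x) ?undup_uniq //= eqxx big1 ?addr0 // => y /negPf->.
  rewrite big_seq big1 // => y yin; case: eqP => // yx.
  by rewrite -yx yin in xn.
exists u; have dF : c - beta u \in F p (N p).
  by apply: submod_rpredB cF _; apply: beta_Fil.
apply/suppP => t; rewrite negb_and rpz_pred => tn.
(* Outside step p the coefficients vanish already. The remaining t have their first repetition
   exactly at p, and [rp_split] names their block. *)
have [|tp] := boolP (((size t)%:Z == N p + 1) && rpz p t); last first.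
  by move/suppP: dF; apply.
move=> /andP[tN tp]; rewrite tN /= in tn.
have [l [t' [tE /codom_ex[x xl] lp]]] := rp_split tp tn.
move: tE lp; rewrite -xl => tE xd.
rewrite tE -tcoef_unpre linearB /= unpre_beta uE.
case: ifP => [_|xn]; first by rewrite fP // subrr linear0.
rewrite !linear0 addr0 tcoef_unpre -tE /tcoef mcoeff_outdom //.
apply/negP => tc; move/negP: xn; apply; rewrite mem_undup; apply/flattenP.
by exists (g t); [apply: map_f | apply: gP tE].
Qed.

(** By [lbd_beta_list] the difference is, up to sign, the face at the last entry y: the block l
    followed by y acting on the cycle. That tail is a boundary. *)
Lemma beta_bd p (u : chain X cycles p.+1) :
  D (beta u) - (-1) ^+ s.+1 *: beta (bd cycles_action a u)
    \in fb D F 1%:Z p (N p).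
Proof.
pose f : {linear chain X cycles p.+1 -> lchain} :=
  (D \o @beta p.+1) \-
  ((-1) ^+ s.+1 \*: (@beta p \o @bd _ _ _ _ cycles_action a p)).
apply: (@supp_ind _ _ _ _ f) (supp_all u) => x z _; rewrite /f /=.
rewrite /beta emb_bd emb_pure; have := size_codom_ord x.
case/lastP: (codom x) => // l y; rewrite size_rcons => -[lp].
have [_ ->] := lbd_beta_list l y z.
rewrite linearB /= scalerBr addrAC subrr add0r.
rewrite -scalerN rpredZ // submod_rpredN // beta_list_pure ?lp //.
(* Putting y in front of [sgn z] is the homotopy: the inner sign cancels that of the head face, and
   the remaining term vanishes since z is a cycle. *)
have -> : aemb X M s (val (compound cycles_action a y z)) =
    D (pre [:: y] (sgn (aemb X M s (val z)))).
  have Dsgn : D (sgn (aemb X M s (val z))) = 0.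
    by apply: oppr_inj; rewrite -sgn_lbd lbd_cycles !linear0.
  rewrite lbd_pre1 sgnK Dsgn linear0 add0r cactE /compound !linear_sum.
  apply: eq_bigr => k _.
  by rewrite !linearZ /= aemb_act.
apply: pre_dup_lbd_fb1 lp _; apply: pre_supp (sgn_supp (aemb_homog _)) => t.
by rewrite /= eqSS.
Qed.

End FirstPage.

(** * The second page *)

Section SecondPage.
Variables (R : comPzRingType) (r : nat) (X : multispindle r).
Variables (M : lmodType R) (A : action X M) (a : 'I_r -> R) (s : nat).
Notation lchain := (tens M (seq X) : lmodType R).
Notation C := (aug_complex A a).
Notation D := (lbd A a).
Notation F := (@Fil R r X M).
Notation cycles := (cycles A a s).
Notation cycles_action := (cycles_action A a s).
Notation H := (homology C s).
Notation H_action := (homology_action (@aug_d_act _ _ _ _ A a) s).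
Notation N p := (p%:Z + s.+1%:Z).
Notation NC := (normalized_complex H_action a).
Notation E rr p q := (fpage D F rr p q).
Notation dE := (@fd _ _ D F (@lbd_lbd _ _ _ _ A a)).

Definition cls : {linear cycles -> H} := quo_pi _.

Definition tcls p (u : chain X cycles p) : chain X H p :=
  tlift (fun x => pure x \o cls) u.

Fact tcls_is_linear p : linear (@tcls p).
Proof. exact: linearP. Qed.
HB.instance Definition _ p := GRing.isLinear.Build R (chain X cycles p)
  (chain X H p) _ (@tcls p) (@tcls_is_linear p).

Lemma tcls_pure p (x : {ffun 'I_p.+1 -> X}) z : tcls (pure x z) = pure x (cls z).
Proof. exact: tlift_pure. Qed.

Lemma cls_act k y z : cls (cycles_action k y z) = H_action k y (cls z).
Proof. by rewrite /cls /= quo_map_pi. Qed.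

Lemma tcls_bd p (u : chain X cycles p.+1) :
  tcls (bd cycles_action a u) = bd H_action a (tcls u).
Proof.
pose f : {linear chain X cycles p.+1 -> chain X H p} :=
  @tcls p \o @bd _ _ _ _ cycles_action a p.
pose g : {linear chain X cycles p.+1 -> chain X H p} :=
  @bd _ _ _ _ H_action a p \o @tcls p.+1.
apply: (@tens_ext _ _ _ _ f g) => x z; rewrite /f /g /= tcls_pure.
rewrite /bd (linear_sum (@tcls p)); apply: eq_bigr => k _.
rewrite (linearZZ (@tcls p)) (linear_sum (@tcls p)); congr (_ *: _).
apply: eq_bigr => i _; rewrite (linearZZ (@tcls p)) !dface_pure /=.
by rewrite tcls_pure cls_act.
Qed.

Lemma tcoef_tcls p (u : chain X cycles p) x :
  tcoef x (tcls u) = cls (tcoef x u).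
Proof.
pose f : {linear chain X cycles p -> H} := tcoef x \o @tcls p.
pose g : {linear chain X cycles p -> H} := cls \o tcoef x.
apply: (@tens_ext _ _ _ _ f g) => y z; rewrite /f /g /= tcls_pure !tcoef_pure.
by case: eqP => // _; rewrite linear0.
Qed.

Lemma tcls_onto p (c : chain X H p) : exists u, tcls u = c.
Proof.
exists (\sum_(x <- msupp (c : {malg H[{ffun 'I_p.+1 -> X}]}))
  pure x (repr (tcoef x c))).
rewrite linear_sum [RHS]tensE; apply: eq_bigr => x _ /=.
by rewrite tcls_pure; congr pure; apply: quo_pi_repr.
Qed.

Lemma cls_eq0 z : cls z = 0 <-> val z \in im_sub (cx_d C s).
Proof.
rewrite -(linear0 cls); split=> [/quo_piP|zB]; first by rewrite subr0.
by apply/quo_piP; rewrite subr0.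
Qed.

Lemma degenerate_coef p (V : lmodType R) (c : chain X V p) :
  c \in degenerate_sub X V p <->
  forall x : {ffun 'I_p.+1 -> X}, ~~ rp p (codom x) -> tcoef x c = 0.
Proof.
have rpE (x : {ffun 'I_p.+1 -> X}) : rp p.+1 (codom x) = rp p (codom x).
  apply/idP/idP; last exact/rp_le.
  by move=> /rp_size; rewrite size_codom_ord.
split=> [/degenerate_emb/Fil_natP/suppP c0 x xd|c0].
  by rewrite -tcoef_emb c0 // rpE (negPf xd) andbF.
by apply: mem_degenerate => x xd; apply: c0; rewrite -rpE.
Qed.

Lemma beta_fb_tcls p (u : chain X cycles p) :
  beta u \in fb D F 1%:Z p (N p) <->
  quo_pi (degenerate_sub X H p) (tcls u) = 0.
Proof.
rewrite beta_fb; transitivity (tcls u \in degenerate_sub X H p).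
  rewrite degenerate_coef; split=> u0 x xd; have := u0 x xd.
    by rewrite tcoef_tcls => /cls_eq0.
  by rewrite tcoef_tcls => /cls_eq0.
rewrite -(linear0 (quo_pi (degenerate_sub X H p))).
by split=> [ud|/quo_piP]; [apply/quo_piP|]; rewrite subr0.
Qed.

(** By [beta_fb_tcls], the maps from the chains with cycle coefficients to E^1 and to the normalized
    chains have the same kernel, so a common lift u determines the correspondence. *)
Definition page1_rel (p : nat) (e : E 1%N p s.+1) (w : NC p) : Prop :=
  exists u : chain X cycles p, represents e (beta u) /\ w = quo_pi _ (tcls u).

Lemma page1_rel_lin (p : nat) c (e e' : E 1%N p s.+1) (w w' : NC p) :
  page1_rel e w -> page1_rel e' w' -> page1_rel (c *: e + e') (c *: w + w').
Proof.
move=> [u [eu ->]] [v [e'v ->]]; exists (c *: u + v).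
split; first by rewrite linearP; apply: represents_lin.
by rewrite (linearP (@tcls p)) linearP.
Qed.

Lemma page1_rel_total (p : nat) (e : E 1%N p s.+1) : exists w, page1_rel e w.
Proof.
have [c ec] := ex_represents e.
have cZ := represents_mem ec; have [u cu] := beta_onto cZ.
exists (quo_pi _ (tcls u)), u; split=> //.
have -> : beta u = c + - (c - beta u) by rewrite opprB addrC subrK.
apply: represents_shift ec _ _; apply: submod_rpredN.
  by apply: submod_rpredB cZ _; apply: beta_fz.
exact: Fil_fb1.
Qed.

Lemma page1_rel_onto (p : nat) (w : NC p) : exists e, page1_rel e w.
Proof.
have [u uE] := tcls_onto (repr w).
have [e eu] : exists e : E 1%N p s.+1, represents e (beta u).
  exact/represents_ex/beta_fz.
by exists e, u; rewrite uE quo_pi_repr.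
Qed.

Lemma page1_rel0 (p : nat) (e : E 1%N p s.+1) (w : NC p) :
  page1_rel e w -> e = 0 <-> w = 0.
Proof. by move=> [u [/represents0 -> ->]]; apply: beta_fb_tcls. Qed.

Lemma page1_rel_d (p : nat) (e : E 1%N p.+1 s.+1) (w : NC p.+1) : page1_rel e w ->
  page1_rel (dE 1%N p.+1 s.+1 p s.+1 e) ((-1) ^+ s.+1 *: cx_d NC p w).
Proof.
move=> [u [eu ->]]; exists ((-1) ^+ s.+1 *: bd cycles_action a u); split.
  have e1 : (p%:Z, s.+1%:Z) = (p.+1%:Z - 1%:Z, s.+1%:Z + 1%:Z - 1).
    by congr (_, _); clear; lia.
  have := represents_fd (@lbd_lbd _ _ _ _ A a) (Fil := F) e1 eu.
  rewrite (linearZZ (@beta _ _ _ _ _ _ _ p)) /=.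
  set x := D _; set y := _ *: _ => ex.
  have -> : y = x + - (x - y) by rewrite opprB addrC subrK.
  have xZ := represents_mem ex.
  have xyB : x - y \in fb D F 1%:Z p (N p) by apply: beta_bd.
  apply: represents_shift ex _ _; apply: submod_rpredN => //.
  apply: submod_rpredB xZ _.
  by rewrite rpredZ //; apply: beta_fz.
rewrite (linearZZ (@tcls p)) linearZZ; congr (_ *: _).
by rewrite /= quo_map_pi /= -tcls_bd.
Qed.

Lemma page1_rel_inj (p : nat) (e e' : E 1%N p s.+1) (w : NC p) :
  page1_rel e w -> page1_rel e' w -> e = e'.
Proof.
move=> ew e'w; have := page1_rel_lin (-1) e'w ew.
by rewrite !scaleN1r addNr addrC => /page1_rel0[_ /(_ erefl) /subr0_eq].
Qed.

Lemma page1_rel_fun (p : nat) (e : E 1%N p s.+1) (w w' : NC p) :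
  page1_rel e w -> page1_rel e w' -> w = w'.
Proof.
move=> ew ew'; have := page1_rel_lin (-1) ew' ew.
by rewrite !scaleN1r addNr addrC => /page1_rel0[/(_ erefl) /subr0_eq].
Qed.

Lemma page2_iso (p : nat) : lmod_iso (E 2%N p s.+1) (homology NC p).
Proof.
(* At p = 0 the target of d^1 is column -1, where the page vanishes; this matches the zero map out
   of degree 0 in [cx_out]. *)
pose p2 : int := if p is p'.+1 then p'%:Z else -1.
have e1 : (p%:Z, s.+1%:Z) = (p.+1%:Z - 1%:Z, s.+1%:Z + 1%:Z - 1).
  by congr (_, _); clear; lia.
have e2 : (p2, s.+1%:Z) = (p%:Z - 1%:Z, s.+1%:Z + 1%:Z - 1).
  by rewrite /p2; case: p {p2 e1} => [|p] //; congr (_, _); clear; lia.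
apply: lmod_iso_trans
  (fpage_next (@lbd_lbd _ _ _ _ A a) (@Fil_le _ _ _ _) _ e1 e2) _ => //.
apply: (homology3_iso (S := @page1_rel p)).
- by move=> c e w e' w'; apply: page1_rel_lin.
- exact: page1_rel_total.
- exact: page1_rel_onto.
- rewrite {}/p2 {e1} in e2 *; case: p e2 => [|p] e2 e w ew.
    by split=> // _; apply: Fil_page_quadrant => //; left.
  rewrite (page1_rel0 (page1_rel_d ew)).
  transitivity (cx_d NC p w = 0); last by [].
  split=> [|->]; last by rewrite scaler0.
  move=> /(congr1 ( *:%R ((-1) ^+ s.+1))).
  by rewrite scalerA -expr2 sqrr_sign scale1r scaler0.
- move=> e w ew; split=> [[e' e'E]|[w' w'E]].
    have [w' ew'] := page1_rel_total e'.
    exists ((-1) ^+ s.+1 *: w'); rewrite linearZZ.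
    by apply: page1_rel_fun ew; rewrite -e'E; apply: page1_rel_d.
  have [e' ew'] := page1_rel_onto ((-1) ^+ s.+1 *: w'); exists e'.
  apply: page1_rel_inj ew; have := page1_rel_d ew'.
  by rewrite linearZZ scalerA -expr2 sqrr_sign scale1r w'E.
Qed.

End SecondPage.

(** * The second page in all bidegrees *)

Lemma HN_zero (R : comPzRingType) (r : nat) (X : multispindle r)
    (V : lmodType R) (B : action X V) (a : 'I_r -> R) (p : int) :
  (forall v : V, v = 0) -> forall w : HN B a p, w = 0.
Proof.
move=> V0; case: p => p w; last exact: thinmx0.
have [y wy] := ex_represents w; apply/(represents0 wy).
suff -> : y = 0 by rewrite rpred0.
rewrite -[y]quo_pi_repr [repr y](_ : _ = 0) ?linear0 //.
by apply: tens_coefP => x; rewrite linear0 (V0 (tcoef _ _)).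
Qed.

Theorem theorem5p4 (R : comPzRingType) (r : nat) (X : multispindle r)
    (M : lmodType R) (A : action X M) (a : 'I_r -> R) :
  exists E : spectral_sequence R,
    converges E (HD A a) /\
    forall p q : int, lmod_iso (E 2%N p q) (HN (Hhat_action A a (q - 2)) a p).
Proof.
exists (degenerate_ss A a); split=> [|p q]; first exact: HD_converges.
have zero : p < 0 \/ q <= 0 -> forall e : degenerate_ss A a 2%N p q, e = 0.
  exact: Fil_page_quadrant.
rewrite /Hhat_action /Hhat; case: p zero => [p|p] zero; last first.
  by apply: lmod_iso_zero => [|w]; [apply: zero; left | apply: thinmx0].
have [q0|q0] := lerP q 0.
  (* The shifted index of the coefficients is q - 1, which is negative here, so [homologyz] gives
     the zero module. *)
  have [k ->] : exists k, q - 2 + 1 = Negz k.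
    by exists `|q|%N; rewrite NegzE; move: q0; clear; lia.
  by apply: lmod_iso_zero; [apply: zero; right | apply/HN_zero/thinmx0].
(* The value s = 0 is the row q = 1, with coefficients in augmented degree -1. *)
have [s qE] : exists s : nat, q = s.+1%:Z.
  by exists `|q|.-1%N; move: q0; clear; lia.
rewrite {}qE; have -> : s.+1%:Z - 2 + 1 = s by clear; lia.
exact: page2_iso.
Qed.
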